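(* Suppose the self-similar measure $\mu$ satisfies the standard technical assumptions, and suppose that the loop class $\Omega'\subseteq\Omega$ is of positive type. Let $y$ and $z$ be positive periodic points in $\Omega'$. Then the set of local dimensions of $\mu$, $\{\dim\mu(x):x\in[0,1],\ \dim\mu(x)\text{ exists}\}$, contains the closed interval with endpoints $\dim\mu(y)$ and $\dim\mu(z)$.
   Context: Measure. Let $m\ge 1$, $0<\varrho<1$, $d_0<\dots<d_m$ real, $S_j(x)=\varrho x+d_j$, $\mathcal A=\{0,\dots,m\}$. For $\sigma=(j_1,\dots,j_n)\in\mathcal A^n$ put $S_\sigma=S_{j_1}\circ\cdots\circ S_{j_n}$. Given $p_j>0$ with $\sum_j p_j=1$, $\mu$ is the unique Borel probability measure with $\mu=\sum_{j=0}^m p_j\,\mu\circ S_j^{-1}$. It is of finite type if there is a finite set $F\subset[0,\infty)$ such that for all $n\ge1$ and $\sigma,\sigma'\in\mathcal A^n$ either $\varrho^{-n}|S_\sigma(0)-S_{\sigma'}(0)|>c$ or $\varrho^{-n}|S_\sigma(0)-S_{\sigma'}(0)|\in F$, where $c=(1-\varrho)^{-1}(d_m-d_0)$. Standard technical assumptions: $\mu$ is such a measure and is of finite type; $p_0=p_m=\min_j p_j$; and $\operatorname{supp}\mu=[0,1]$ (equivalently $d_0=0$, $d_m=1-\varrho$, $d_{i+1}-d_i\le\varrho$ for all $i$). Local dimension. $\dim\mu(x)=\lim_{r\to0^+}\frac{\log\mu([x-r,x+r])}{\log r}$ when the limit exists (it exists at every periodic point). Net intervals and characteristic vectors. For $n\ge1$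 let $h_1<\dots<h_{s_n}$ be the distinct elements of $\{S_\sigma(0),S_\sigma(1):\sigma\in\mathcal A^n\}$; the net intervals of level $n$ are $\mathcal F_n=\{[h_j,h_{j+1}]:1\le j<s_n\}$, and $\mathcal F_0=\{[0,1]\}$. Each $\Delta\in\mathcal F_n$ ($n\ge1$) lies in a unique $\widehat\Delta\in\mathcal F_{n-1}$, its parent ($\Delta$ is a child of $\widehat\Delta$). For $\Delta=[a,b]\in\mathcal F_n$ put $\ell_n(\Delta)=\varrho^{-n}(b-a)$, and let $V_n(\Delta)=(a_1,\dots,a_k)$ be the increasing list of the distinct values $\varrho^{-n}(a-S_\sigma(0))$ over $\sigma\in\mathcal A^n$ with $\Delta\subseteq S_\sigma[0,1]$. Let $r_n(\Delta)$ be the position of $\Delta$, from left to right, among the children of $\widehat\Delta$ with the same $\ell_n$ and $V_n$. The characteristic vector is $\mathcal C_n(\Delta)=(\ell_n(\Delta),V_n(\Delta),r_n(\Delta))$, with $\mathcal C_0([0,1])=(1,(0),1)$. $\Omega$ is the (finite) set of all characteristic vectors. $\beta\in\Omega$ is a child of $\alpha\in\Omega$ (its parent) if $\alpha=\mathcal C_{n-1}(\widehat\Delta)$, $\beta=\mathcal C_n(\Delta)$ for some parent/child pair. An admissible path is a tuple $(\gamma_1,\dots,\gamma_n)$ in $\Omega$ with each $\gamma_j$ the parent of $\gamma_{j+1}$; its length is $n$. A symbolic representation of $x\in[0,1]$ is $[x]=(\mathcal C_0(\Delta_0),\mathcal C_1(\Delta_1),\dots)$, where $x\in\Delta_n\in\mathcal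 F_n$ and $\Delta_n$ is the parent of $\Delta_{n+1}$ for all $n$ (unique unless $x$ is an endpoint of a net interval, in which case there may be two). Transition matrices. For $\Delta=[a,b]\in\mathcal F_n$ with parent $\widehat\Delta=[c,d]$, $V_n(\Delta)=(a_1,\dots,a_K)$, $V_{n-1}(\widehat\Delta)=(c_1,\dots,c_J)$, the primitive transition matrix $T(\mathcal C_{n-1}(\widehat\Delta),\mathcal C_n(\Delta))$ is the $J\times K$ matrix with $(j,k)$ entry $p_0^{-1}p_\ell$ if $\ell\in\mathcal A$ satisfies $c-\varrho^{n-1}c_j+\varrho^{n-1}d_\ell=a-\varrho^na_k$, and $0$ if there is no such $\ell$ (it depends only on the two characteristic vectors). For an admissible path, $T(\gamma_1,\dots,\gamma_n)=T(\gamma_1,\gamma_2)\cdots T(\gamma_{n-1},\gamma_n)$. A matrix is positive if all entries are strictly positive. Loop classes. A non-empty $\Omega'\subseteq\Omega$ is a loop class if for all $\alpha,\beta\in\Omega'$ there is an admissible path $(\gamma_1,\dots,\gamma_n)$, $n\ge2$, with all $\gamma_j\in\Omega'$, $\gamma_1=\alpha$, $\gamma_n=\beta$. It is of positive type if some admissible path $\eta$ in $\Omega'$ (all its members in $\Omega'$) has $T(\eta)$ positive. Periodic points. $x$ is periodic with period $\theta$ if it has a symbolic representation $(\gamma_0,\dots,\gamma_s,\theta^-,\theta^-,\dots)$, where $\theta$ is an admissible cycle (a path of length at least 2 with equal first and last letters) and $\theta^-$ is $\theta$ with its last letter deleted. A positive periodic point in $\Omega'$ is one having such a period $\theta$ lying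 in $\Omega'$ with $T(\theta)$ positive. *)

(* Defs.v *)
From mathcomp Require Import all_boot all_order all_algebra.
From mathcomp Require Import all_classical all_reals all_analysis.

Set Implicit Arguments.
Unset Strict Implicit.
Unset Printing Implicit Defensive.

Import Order.TTheory GRing.Theory Num.Theory.
Import numFieldNormedType.Exports.

Local Open Scope classical_set_scope.
Local Open Scope ring_scope.

(** Weighted equicontractive iterated function systems
    x |-> rho * x + d_j, j = 0, ..., m, on the real line. *)

Record wifs (R : realType) := Wifs {
  msize : nat;
  rho : R;
  d : 'I_msize.+1 -> R;
  p : 'I_msize.+1 -> R;
  msize_ge1 : (1 <= msize)%N;
  rho_gt0 : 0 < rho;
  rho_lt1 : rho < 1;
  d_incr : forall i j : 'I_msize.+1, (i < j)%N -> d i < d j;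
  p_gt0 : forall j, 0 < p j;
  p_sum1 : \sum_j p j = 1
}.

Definition alphabet (R : realType) (w : wifs R) := 'I_(msize w).+1.

Definition S1 (R : realType) (w : wifs R) (j : alphabet w) (x : R) : R :=
  rho w * x + d j.

Definition Sw (R : realType) (w : wifs R) (s : seq (alphabet w)) (x : R) : R :=
  foldr (@S1 R w) x s.

(** Self-similarity determines the Borel probability measure uniquely. *)
Definition self_similar (R : realType) (w : wifs R)
    (mu : probability (measurableTypeR R) R) : Prop :=
  forall A : set (measurableTypeR R), measurable A ->
    mu A = (\sum_(j : 'I_(msize w).+1) (p j)%:E * mu (@S1 R w j @^-1` A))%E.

Definition finite_type (R : realType) (w : wifs R) : Prop :=
  let c := (1 - rho w)^-1 * (d (@ord_max (msize w)) - d (@ord0 (msize w))) in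
  exists F : set R,
    [/\ finite_set F, F `<=` [set x | 0 <= x] &
        forall (n : nat), (1 <= n)%N -> forall s t : n.-tuple (alphabet w),
          let q := rho w ^- n * `|Sw s 0 - Sw t 0| in c < q \/ F q].

Definition supp (R : realType) (mu : probability (measurableTypeR R) R) :
    set R :=
  [set x | forall U : set R, open U -> U x -> (0 < mu U)%E].

Definition standard_assumptions (R : realType) (w : wifs R)
    (mu : probability (measurableTypeR R) R) : Prop :=
  [/\ self_similar w mu,
      finite_type w,
      p (@ord0 (msize w)) = p (@ord_max (msize w))
        /\ (forall j : alphabet w, p (@ord0 (msize w)) <= p j) &
      supp mu = `[0, 1]%classic].

(** The limit is sought in R rather than in the extended reals:
    at a point of supp mu the quotient is bounded near 0. [locdim] is
    meaningful only where [has_locdim] holds. *)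

Definition locdim_quotient (R : realType)
    (mu : probability (measurableTypeR R) R) (x r : R) : R :=
  ln (fine (mu `[x - r, x + r]%classic)) / ln r.

Definition has_locdim (R : realType)
    (mu : probability (measurableTypeR R) R) (x : R) : Prop :=
  cvg (locdim_quotient mu x r @[r --> 0^'+]).

Definition locdim (R : realType)
    (mu : probability (measurableTypeR R) R) (x : R) : R :=
  lim (locdim_quotient mu x r @[r --> 0^'+]).

Definition locdims (R : realType)
    (mu : probability (measurableTypeR R) R) : set R :=
  [set locdim mu x | x in [set x | 0 <= x <= 1 /\ has_locdim mu x]].

(** A net interval [a, b] is represented by the pair (a, b). *)

Definition interv (R : realType) : Type := (R * R)%type.

Definition subinterv (R : realType) (D E : interv R) : bool :=
  (E.1 <= D.1) && (D.2 <= E.2).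

Definition endpoints (R : realType) (w : wifs R) (n : nat) : seq R :=
  sort <=%R (undup
    ([seq Sw s 0 | s : n.-tuple (alphabet w)] ++
     [seq Sw s 1 | s : n.-tuple (alphabet w)])).

(** The net intervals of level n from left to right. As the only word of length
    0 is empty, level 0 consists of [0, 1] alone. *)
Definition net (R : realType) (w : wifs R) (n : nat) : seq (interv R) :=
  zip (endpoints w n) (behead (endpoints w n)).

Definition is_child (R : realType) (w : wifs R) (n : nat)
    (E D : interv R) : bool :=
  [&& E \in net w n, D \in net w n.+1 & subinterv D E].

(** The parent of a net interval of level n.+1 ((0, 1) is a dummy value). *)
Definition parent (R : realType) (w : wifs R) (n : nat) (D : interv R) :
    interv R :=
  head (0, 1) [seq E <- net w n | subinterv D E].

Definition ell (R : realType) (w : wifs R) (n : nat) (D : interv R) : R :=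
  rho w ^- n * (D.2 - D.1).

Definition Vn (R : realType) (w : wifs R) (n : nat) (D : interv R) : seq R :=
  sort <=%R (undup
    [seq rho w ^- n * (D.1 - Sw s 0)
       | s : n.-tuple (alphabet w) <- enum {: n.-tuple (alphabet w)} &
             subinterv D (Sw s 0, Sw s 1)]).

Definition rn (R : realType) (w : wifs R) (n : nat) (D : interv R) : nat :=
  if n is k.+1 then
    (index D [seq E <- net w n |
               [&& is_child w k (parent w k D) E,
                   ell w n E == ell w n D & Vn w n E == Vn w n D]]).+1
  else 1%N.

Definition cvec (R : realType) : Type := (R * seq R * nat)%type.

Definition nbr (R : realType) (a : cvec R) : seq R := a.1.2.

Definition charvec (R : realType) (w : wifs R) (n : nat) (D : interv R) :
    cvec R :=
  (ell w n D, Vn w n D, rn w n D).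

Definition Omega (R : realType) (w : wifs R) : set (cvec R) :=
  [set a | exists (n : nat) (D : interv R),
     D \in net w n /\ a = charvec w n D].

Definition realizes (R : realType) (w : wifs R) (a b : cvec R)
    (q : nat * interv R * interv R) : Prop :=
  let: (n, E, D) := q in
  [/\ is_child w n E D, a = charvec w n E & b = charvec w n.+1 D].

(** [child w a b] : b is a child of a. *)
Definition child (R : realType) (w : wifs R) (a b : cvec R) : bool :=
  `[< exists q, realizes w a b q >].

(** An admissible path is given by its head a and its tail s, as in the theory
    of [path]; its length is (size s).+1. *)
Definition admissible (R : realType) (w : wifs R) (a : cvec R)
    (s : seq (cvec R)) : Prop :=
  Omega w a /\ path (child w) a s.

Definition path_in (R : realType) (X : set (cvec R)) (a : cvec R)
    (s : seq (cvec R)) : Prop :=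
  forall b, b \in a :: s -> X b.

Definition trans_entry (R : realType) (w : wifs R)
    (n : nat) (E D : interv R) (x y : R) : R :=
  if [pick l : alphabet w |
       E.1 - rho w ^+ n * x + rho w ^+ n * d l == D.1 - rho w ^+ n.+1 * y]
  is Some l then (p (@ord0 (msize w)))^-1 * p l else 0.

(** The matrix depends only on the two characteristic vectors, so any parent /
    child pair of net intervals realizing them may be used. *)
Definition Tmat1 (R : realType) (w : wifs R) (a b : cvec R) :
    'M[R]_(size (nbr a), size (nbr b)) :=
  let: (n, E, D) := xget (0%N, (0, 1), (0, 1)) (realizes w a b) in
  \matrix_(j, k) trans_entry w n E D (nth 0 (nbr a) j) (nth 0 (nbr b) k).

(** For a path of length 1 this is the empty product, an identity matrix. *)
Fixpoint Tmat (R : realType) (w : wifs R) (a : cvec R) (s : seq (cvec R)) :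
    'M[R]_(size (nbr a), size (nbr (last a s))) :=
  match s return 'M[R]_(size (nbr a), size (nbr (last a s))) with
  | [::] => 1%:M
  | b :: s' => Tmat1 w a b *m Tmat w b s'
  end.

Definition positive_mx (R : realType) (k l : nat) (A : 'M[R]_(k, l)) : Prop :=
  forall i j, 0 < A i j.

Definition loop_class (R : realType) (w : wifs R) (X : set (cvec R)) : Prop :=
  [/\ X !=set0, X `<=` Omega w &
      forall a b, X a -> X b -> exists s,
        [/\ s != [::], admissible w a s, path_in X a s & last a s = b]].

Definition positive_type (R : realType) (w : wifs R) (X : set (cvec R)) :
    Prop :=
  exists a s, [/\ admissible w a s, path_in X a s & positive_mx (Tmat w a s)].

Definition symbolic_rep (R : realType) (w : wifs R) (x : R)
    (g : nat -> cvec R) : Prop :=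
  exists Delta : nat -> interv R,
    [/\ forall n, (Delta n).1 <= x <= (Delta n).2,
        forall n, is_child w n (Delta n) (Delta n.+1) &
        forall n, g n = charvec w n (Delta n)].

Definition admissible_cycle (R : realType) (w : wifs R) (a : cvec R)
    (t : seq (cvec R)) : Prop :=
  [/\ t != [::], admissible w a t & last a t = a].

(** [belast a t] is the path a :: t with its last letter deleted. *)
Definition has_period (R : realType) (w : wifs R) (x : R) (a : cvec R)
    (t : seq (cvec R)) : Prop :=
  admissible_cycle w a t /\
  exists (g : nat -> cvec R) (s : nat),
    symbolic_rep w x g /\
    forall k, g (s.+1 + k)%N = nth a (belast a t) (k %% size t).

Definition positive_periodic (R : realType) (w : wifs R) (X : set (cvec R))
    (x : R) : Prop :=
  exists a t, [/\ has_period w x a t, path_in X a t & positive_mx (Tmat w a t)].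

(* Main.v *)
(** A path of characteristic vectors determines a net interval below any net
    interval Delta of level n whose characteristic vector is its first letter.
    Let Q(Delta) be the sum of the weights p_sigma over the words sigma of length n
    whose interval contains Delta; finite type makes Q(Delta) and mu(Delta)
    comparable, and Q(Delta) evolves along a path through the transition matrices.
    After a path with positive matrix all coordinates of the mass vector are
    comparable, so that the growth of Q along the rest of the path no longer depends
    on the past: repeating a positive cycle theta j times multiplies Q by
    exp (j lam + O(1)), for some lam depending on theta only.

    At a periodic point this gives the local dimension lam / (|theta| log rho): either
    the point stays away from the endpoints of its net intervals, or it is itself
    an endpoint, and then p_0 = p_m shows that the words missed by Q contribute
    at most a linear factor. If y and z have different dimensions, their periods
    lead to distinct net intervals, whence a cycle iota that leads strictly inside
    every net interval. The point whose path consists of the blocks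
    iota^M theta^(m_k) u phi^(m'_k) v, where m_k and m'_k are proportional
    to 2k+1, is then far from the endpoints of its net intervals, and its
    local dimension is the prescribed convex combination: after k blocks level and
    log Q are quadratic in k, with errors O(k). *)

Require Import Defs.
From mathcomp Require Import all_boot all_order all_algebra.
From mathcomp Require Import all_classical all_reals all_analysis.
From mathcomp Require Import measurable_realfun.
From mathcomp Require Import ring lra zify.

Set Implicit Arguments.
Unset Strict Implicit.
Unset Printing Implicit Defensive.

Import Order.TTheory GRing.Theory Num.Theory.
Import numFieldNormedType.Exports.

Local Open Scope classical_set_scope.
Local Open Scope ring_scope.

(** * Words over the alphabet and weighted sums over words of a given length *)

Section Words.
Variables (R : realType) (w : wifs R).

Lemma S1E j x : @S1 R w j x = rho w * x + d j. Proof. by []. Qed.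

Lemma Sw_rcons s l x : @Sw R w (rcons s l) x = Sw s (S1 l x).
Proof. exact: foldr_rcons. Qed.

Lemma SwE s x : @Sw R w s x = Sw s 0 + rho w ^+ size s * x.
Proof.
elim: s x => [|j s IH] x /=; first by rewrite expr0 mul1r add0r.
by rewrite !S1E IH exprS; ring.
Qed.

Lemma rhoX_gt0 n : 0 < rho w ^+ n.
Proof. by rewrite exprn_gt0// rho_gt0. Qed.

Lemma rhoX_neq0 n : rho w ^+ n != 0.
Proof. by rewrite gt_eqF// rhoX_gt0. Qed.

Lemma rhoX_small e : 0 < e -> exists n, rho w ^+ n < e.
Proof.
move=> e0.
have h : (fun n => (rho w) ^+ n) @ \oo --> (0 : R).
  by apply: cvg_expr; rewrite ger0_norm ?rho_lt1// ltW// rho_gt0.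
have := @cvgr_lt _ _ _ _ _ _ h _ e0.
by case=> N _ /(_ N (leqnn _)) ?; exists N.
Qed.

(** The sum of p_s F(s) over the words s of length n. The last letter is split off because passing
    from a net interval to a child appends a letter on the right. *)
Fixpoint wsum (n : nat) (F : seq (alphabet w) -> R) : R :=
  if n is k.+1 then wsum k (fun s => \sum_l p l * F (rcons s l)) else F [::].

Lemma p_ge0 (l : alphabet w) : 0 <= p l. Proof. exact/ltW/p_gt0. Qed.

Lemma ler_wsum n F G : (forall s, size s = n -> F s <= G s) ->
  wsum n F <= wsum n G.
Proof.
elim: n F G => [|n IH] F G h /=; first exact: h.
apply: IH => s sn; apply: ler_sum => l _.
by apply: ler_wpM2l; [exact: p_ge0|apply: h; rewrite size_rcons sn].
Qed.

Lemma eq_wsum n F G : (forall s, size s = n -> F s = G s) ->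
  wsum n F = wsum n G.
Proof.
by move=> h; apply/eqP; rewrite eq_le !ler_wsum// => s /h ->.
Qed.

Lemma wsumZ n a F : wsum n (fun s => a * F s) = a * wsum n F.
Proof.
elim: n F => [//|n IH] F /=; rewrite -IH; apply: eq_wsum => s _.
by rewrite big_distrr/=; apply: eq_bigr => l _; rewrite mulrCA.
Qed.

Lemma wsumD n F G : wsum n (fun s => F s + G s) = wsum n F + wsum n G.
Proof.
elim: n F G => [//|n IH] F G /=; rewrite -IH; apply: eq_wsum => s _.
by rewrite -big_split/=; apply: eq_bigr => l _; rewrite mulrDr.
Qed.

Lemma wsum0 n : wsum n (fun=> 0) = 0.
Proof.
have := wsumZ n 0 (fun=> 0); by rewrite !mul0r.
Qed.

Lemma wsum_sum n (I : Type) (r : seq I) F :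
  wsum n (fun s => \sum_(i <- r) F i s) = \sum_(i <- r) wsum n (F i).
Proof.
elim: r => [|i r IH].
  by rewrite big_nil -[RHS](wsum0 n); apply: eq_wsum => s _; rewrite big_nil.
by rewrite big_cons -IH -wsumD; apply: eq_wsum => s _; rewrite big_cons.
Qed.

Lemma wsum_ge0 n F : (forall s, size s = n -> 0 <= F s) -> 0 <= wsum n F.
Proof. by move=> h; rewrite -(wsum0 n); exact: ler_wsum. Qed.

Lemma wsum_gt0 n F t : (forall s, size s = n -> 0 <= F s) ->
  size t = n -> 0 < F t -> 0 < wsum n F.
Proof.
elim: n F t => [|n IH] F t h /=; first by move/size0nil->.
case/lastP: t => [//|t l]; rewrite size_rcons => -[tn] Ft.
apply: (IH _ t) => // [s sn|].
  by apply: sumr_ge0 => j _; rewrite mulr_ge0 ?p_ge0// h// size_rcons sn.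
apply: (@lt_le_trans _ _ (p l * F (rcons t l))).
  by rewrite mulr_gt0// p_gt0.
rewrite (bigD1 l)//= lerDl; apply: sumr_ge0 => j _.
by rewrite mulr_ge0 ?p_ge0// h// size_rcons tn.
Qed.

End Words.

(** * Masses of intervals and the consequences of supp mu = [0, 1] *)

Section Support.
Variables (R : realType) (w : wifs R) (mu : probability (measurableTypeR R) R).
Hypothesis Hmu : standard_assumptions w mu.

Definition mass (A : set R) : R := fine (mu A).

Lemma mass_ge0 A : 0 <= mass A.
Proof. exact/fine_ge0/measure_ge0. Qed.

Lemma massE (a b : R) : mu `[a, b]%classic = (mass `[a, b]%classic)%:E.
Proof. by rewrite /mass fineK// fin_num_measure. Qed.

Lemma le_mass (a b a' b' : R) : a' <= a -> b <= b' ->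
  mass `[a, b]%classic <= mass `[a', b']%classic.
Proof.
move=> aa bb; rewrite -lee_fin -!massE; apply: le_measure; rewrite ?inE//.
by apply: subset_itv; rewrite bnd_simp.
Qed.

Lemma mass_le1 (a b : R) : mass `[a, b]%classic <= 1.
Proof. by rewrite -lee_fin -massE; exact: probability_le1. Qed.

Lemma S1_preimage (j : alphabet w) (a b : R) :
  @S1 R w j @^-1` `[a, b]%classic
  = `[(rho w)^-1 * (a - d j), (rho w)^-1 * (b - d j)]%classic.
Proof.
have r0 := rho_gt0 w.
apply/seteqP; split => x /=; rewrite !in_itv/= S1E.
  by rewrite ![(rho w)^-1 * _]mulrC ler_pdivrMr// ler_pdivlMr// => /andP[??];
    apply/andP; split; lra.
rewrite ![(rho w)^-1 * _]mulrC ler_pdivrMr// ler_pdivlMr// => /andP[??].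
by apply/andP; split; lra.
Qed.

Lemma mass_self_similar (a b : R) : mass `[a, b]%classic =
  \sum_l p l * mass (@S1 R w l @^-1` `[a, b]%classic).
Proof.
case: Hmu => ss _ _ _; apply: EFin_inj; rewrite -massE ss// -sumEFin.
by apply: eq_bigr => l _; rewrite S1_preimage EFinM -massE.
Qed.

(** The preimage of [a, b] under [Sw s], written as an interval so that the estimates for intervals
    apply to it. *)
Definition word_preimage s (a b : R) : set R :=
  `[rho w ^- size s * (a - @Sw R w s 0), rho w ^- size s * (b - @Sw R w s 0)]%classic.

Lemma mass_wsum n (a b : R) :
  mass `[a, b]%classic = wsum n (fun s => mass (word_preimage s a b)).
Proof.
elim: n => [|n ->] /=.
  by rewrite /word_preimage/= expr0 invr1 !mul1r !subr0.
apply: eq_wsum => s sn; rewrite mass_self_similar; apply: eq_bigr => l _.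
rewrite S1_preimage /word_preimage size_rcons sn Sw_rcons S1E mulr0 add0r.
rewrite (SwE s (d l)) sn.
have r0 : rho w != 0 by rewrite gt_eqF// rho_gt0.
have rn := rhoX_neq0 w n.
have e t u : rho w ^- n.+1 * (t - (u + rho w ^+ n * d l))
    = (rho w)^-1 * (rho w ^- n * (t - u) - d l).
  by rewrite exprS; field; apply/andP.
by rewrite !e.
Qed.

(** Were [a, b] disjoint from supp mu = [0, 1], each of its points would have a null open
    neighbourhood; by compactness finitely many of these cover [a, b], which would be null. *)
Lemma supp_itv (a b : R) : 0 < mass `[a, b]%classic ->
  exists2 x, a <= x <= b & 0 <= x <= 1.
Proof.
case: Hmu => _ _ _ sp m0; apply: contrapT => nx.
have h : forall x, `[a, b]%classic x ->
    exists U : set R, [/\ open U, U x & mu U = 0%E].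
  move=> x /= xab; apply: contrapT => nU; apply: nx; exists x.
    by move: xab; rewrite in_itv.
  have : supp mu x.
    move=> U oU Ux; rewrite lt_neqAle measure_ge0 andbT eq_sym.
    by apply/eqP => U0; apply: nU; exists U.
  by rewrite sp /= in_itv.
have : compact (`[a, b]%classic : set R) by exact: segment_compact.
rewrite compact_cover => cc.
pose f (x : R) : set R := xget set0 [set U : set R | [/\ open U, U x & mu U = 0%E]].
have fP x : `[a, b]%classic x -> [/\ open (f x), f x x & mu (f x) = 0%E].
  by move=> /h [U hU]; rewrite /f; case: xgetP => [V -> //|/(_ U)].
have [|x /= xab|D sD cD] := cc _ `[a, b]%classic f.
- by move=> x /fP[].
- by exists x => //; case: (fP x xab).
move: cD; set E := (X in cover X _) => cD.
have finE : finite_set E by exact: finite_fset.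
have {}sD x : E x -> `[a, b]%classic x by move=> /sD; rewrite inE.
have mf x : E x -> measurable (f x : set (measurableTypeR R)).
  by move=> /sD /fP[oU _ _]; exact: open_measurable.
suff : mu `[a, b]%classic = 0%E by rewrite massE => -[m00]; rewrite m00 ltxx in m0.
apply/eqP; rewrite eq_le measure_ge0 andbT.
apply: le_trans (@content_sub_fsum _ _ _ mu _ E _ f finE mf _ cD) _ => //.
by rewrite fsbig1//= => x /sD/fP[].
Qed.

Lemma mass_outside (a b : R) : b < 0 \/ 1 < a -> mass `[a, b]%classic = 0.
Proof.
move=> ab; apply/eqP; rewrite eq_le mass_ge0 andbT leNgt; apply/negP.
by move=> /supp_itv[x /andP[? ?] /andP[? ?]]; case: ab => ?; lra.
Qed.

Lemma mass_gt0 (a b : R) : 0 <= a -> a < b -> b <= 1 ->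
  0 < mass `[a, b]%classic.
Proof.
move=> a0 ab b1; case: Hmu => _ _ _ sp.
have : supp mu ((a + b) / 2) by rewrite sp/= in_itv/=; apply/andP; split; lra.
have oI : open (`]a, b[%classic : set R) by exact: interval_open.
move=> /(_ _ oI)/=.
rewrite in_itv/= => /(_ _) h; rewrite -lte_fin -massE.
apply: lt_le_trans (h _) _; first by apply/andP; split; lra.
by apply: le_measure; rewrite ?inE//; exact: subset_itv_oo_cc.
Qed.

Lemma fin_pos_min (T : eqType) (s : seq T) (f : T -> R) :
  (forall x, x \in s -> 0 < f x) -> exists2 e, 0 < e & forall x, x \in s -> e <= f x.
Proof.
elim: s => [|x s IH] h; first by exists 1.
have [|e e0 he] := IH; first by move=> y ys; apply: h; rewrite inE ys orbT.
exists (Num.min e (f x)); first by rewrite lt_min e0 h// mem_head.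
move=> y; rewrite inE => /orP[/eqP->|/he ey]; rewrite ge_min ?lexx ?orbT//.
by rewrite ey.
Qed.

(** As p_j > 0, self-similarity makes [S1 j] map supp mu = [0, 1] into itself; the two inequalities
    are read off at 0 and 1. *)
Lemma stable_supp (j : alphabet w) : 0 <= d j /\ d j + rho w <= 1.
Proof.
case: Hmu => ss _ _ sp.
have h (x : R) : 0 <= x <= 1 -> 0 <= S1 j x <= 1.
  move=> x01; have sx : supp mu x by rewrite sp/= in_itv.
  suff : supp mu (S1 j x) by rewrite sp/= in_itv.
  move=> U oU Ux; have oV : open (@S1 R w j @^-1` U).
    apply: open_comp => // y _; apply: cvgD; last exact: cvg_cst.
    by apply: cvgM; [exact: cvg_cst|exact: cvg_id].
  have V0 := sx _ oV Ux.
  rewrite (ss _ (open_measurable oU)) (bigD1 j) //.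
  apply: lt_le_trans (_ : (p j)%:E * mu (@S1 R w j @^-1` U) <= _)%E.
    by apply: mule_gt0 => //; rewrite lte_fin p_gt0.
  rewrite leeDl//; apply: sume_ge0 => l _; apply: mule_ge0 => //.
  by rewrite lee_fin p_ge0.
have := h 0; have := h 1; rewrite !S1E !lexx ler01 => /(_ isT)/andP[_ ?] /(_ isT)/andP[? _].
by split; lra.
Qed.

(** A point x missed by every interval [S1 j] [0, 1] has distance at least some e > 0 from all of
    them. The preimages of [x - e/2, x + e/2] then lie off [0, 1], so this neighbourhood is null by
    self-similarity although x is in the support. *)
Lemma cover_supp (x : R) : 0 <= x <= 1 ->
  exists j : alphabet w, d j <= x <= d j + rho w.
Proof.
move=> x01; case: (Hmu) => _ _ _ sp; apply: contrapT => nj.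
(* The distance from x to the interval [d_j, d_j + rho]. *)
pose g (j : alphabet w) := if x < d j then d j - x else x - (d j + rho w).
have [j _|e e0 he] := @fin_pos_min _ (enum {: alphabet w}) g.
  rewrite /g; case: ifPn => [|]; first by rewrite subr_gt0.
  rewrite -leNgt subr_gt0 => dx; rewrite ltNge; apply/negP => xd.
  by apply: nj; exists j; rewrite dx xd.
have : supp mu x by rewrite sp/= in_itv.
have oI : open (`]x - e / 2, x + e / 2[%classic : set R) by exact: interval_open.
move=> /(_ _ oI)/=.
rewrite in_itv/= => h.
have {h} : 0 < mass `[x - e / 2, x + e / 2]%classic.
  rewrite -lte_fin -massE; apply: lt_le_trans (h _) _.
    by apply/andP; split; lra.
  by apply: le_measure; rewrite ?inE//; exact: subset_itv_oo_cc.
rewrite mass_self_similar big1 ?ltxx// => l _.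
apply/eqP; rewrite mulf_eq0; apply/orP; right.
rewrite eq_le mass_ge0 andbT leNgt; apply/negP.
rewrite S1_preimage => /supp_itv[y].
have r0 := rho_gt0 w.
rewrite ![(rho w)^-1 * _]mulrC ler_pdivrMr// ler_pdivlMr// => /andP[y1 y2] /andP[y3 y4].
have : y * rho w <= rho w by rewrite ler_piMl// ltW.
have : 0 <= y * rho w by rewrite mulr_ge0// ltW.
have := he l (mem_enum _ l); rewrite /g; case: ifPn => [?|]; first lra.
by rewrite -leNgt; lra.
Qed.

(** An interval [S1 j] [0, 1] containing 0 has d_j = 0, and monotonicity of d leaves only j = 0;
    [d_last] is symmetric. *)
Lemma d_first : d (@ord0 (msize w)) = 0.
Proof.
have [|j /andP[dj _]] := cover_supp (x := 0); first by rewrite lexx ler01.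
have [dj0 _] := stable_supp j; have [d0 _] := stable_supp ord0.
have [j0|j0] := posnP j.
  have -> : ord0 = j by apply/val_inj; rewrite /= j0.
  by lra.
by have := @d_incr _ w ord0 j j0; lra.
Qed.

Lemma d_last : d (@ord_max (msize w)) = 1 - rho w.
Proof.
have [|j /andP[_ dj]] := cover_supp (x := 1); first by rewrite lexx ler01.
have [_ dj0] := stable_supp j; have [_ d0] := stable_supp ord_max.
have := leq_ord j; rewrite leq_eqVlt => /orP[/eqP jm|jm].
  have -> : ord_max = j by apply/val_inj.
  by lra.
by have := @d_incr _ w j ord_max jm; lra.
Qed.
End Support.

(** * Consecutive pairs of a strictly increasing list *)

Section ZipBehead.
Variable R : realType.
Implicit Type s : seq R.

Lemma mem_zip_behead s a b : sorted <%R s ->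
  ((a, b) \in zip s (behead s)) <->
  [/\ a \in s, b \in s, a < b & forall h, h \in s -> h <= a \/ b <= h].
Proof.
elim: s => [|x [|y s] IH] //=; first by move=> _; split=> // -[].
  move=> _; split=> // -[]; rewrite !inE => /eqP-> /eqP->.
  by rewrite ltxx.
move=> /andP[xy ps]; have {}IH := IH ps.
have ys h : h \in y :: s -> y <= h.
  rewrite inE => /orP[/eqP->//|hs]; apply/ltW.
  by have /allP := order_path_min lt_trans ps; apply.
rewrite /= in IH; rewrite inE; split.
  case/orP => [/eqP[-> ->]|/IH[h1 h2 h3 h4]].
    split; rewrite ?inE ?eqxx ?orbT// => h; rewrite inE.
    by case/orP => [/eqP->|/ys]; [left|right].
  split; rewrite 1?inE ?h1 ?h2 ?orbT// => h; rewrite inE => /orP[/eqP->|/h4//].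
  by left; apply: (le_trans (ltW xy)); exact: ys.
case; rewrite inE => /orP[/eqP->|ays].
  rewrite inE => /orP[/eqP->|bys]; first by rewrite ltxx.
  move=> _ /(_ y); rewrite !inE eqxx orbT => /(_ isT)[|by_].
    by rewrite leNgt xy.
  by apply/orP; left; rewrite (@le_anti _ _ b y)// by_ ys.
move=> bs ab h; apply/orP; right; apply/IH; split => //.
  by move: bs; rewrite inE => /orP[/eqP bx|//]; have := ys _ ays; lra.
by move=> z zs; apply: h; rewrite inE zs orbT.
Qed.

(** The left-to-right order of net intervals matters for [rn], which is a position among
    siblings. *)
Lemma sorted_zip_behead s : sorted <%R s ->
  sorted (fun D E : interv R => D.2 < E.2) (zip s (behead s)).
Proof.
move=> ss; have : sorted <%R (unzip2 (zip s (behead s))).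
  rewrite unzip2_zip; last by rewrite size_behead leq_pred.
  by case: s ss => //= x s /path_sorted.
by rewrite sorted_map.
Qed.

End ZipBehead.

(** * Net intervals and the words whose intervals cover them *)

Section Nets.
Variables (R : realType) (w : wifs R) (mu : probability (measurableTypeR R) R).
Hypothesis Hmu : standard_assumptions w mu.

Definition isend n (h : R) :=
  exists2 s, size s = n & h = @Sw R w s 0 \/ h = Sw s 1.

Definition cov (s : seq (alphabet w)) (D : interv R) : bool :=
  subinterv D (Sw s 0, Sw s 1).

Lemma mem_endpoints n h : h \in endpoints w n <-> isend n h.
Proof.
rewrite mem_sort mem_undup mem_cat; split.
  by case/orP => /mapP[s _ ->]; exists s; rewrite ?size_tuple//; [left|right].
case=> s /eqP sn [] ->; apply/orP; [left|right];
  by apply/mapP; exists (Tuple sn); rewrite ?mem_enum.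
Qed.

Lemma netP n (D : interv R) : D \in net w n <->
  [/\ isend n D.1, isend n D.2, D.1 < D.2
    & forall h, isend n h -> h <= D.1 \/ D.2 <= h].
Proof.
case: D => a b /=.
have ss : sorted <%R (endpoints w n) by rewrite sort_lt_sorted undup_uniq.
split.
  move=> /(mem_zip_behead _ _ ss)[/mem_endpoints h1 /mem_endpoints h2 h3 h4].
  by split=> // h /mem_endpoints/h4.
move=> [/mem_endpoints h1 /mem_endpoints h2 h3 h4].
by apply/(mem_zip_behead _ _ ss); split=> // h /mem_endpoints/h4.
Qed.

Lemma sorted_net n : sorted (fun D E : interv R => D.2 < E.2) (net w n).
Proof. by apply: sorted_zip_behead; rewrite sort_lt_sorted undup_uniq. Qed.

Lemma net_lt n D : D \in net w n -> D.1 < D.2.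
Proof. by move/netP => []. Qed.

Lemma Sw_01 s x : 0 <= x <= 1 -> 0 <= @Sw R w s x <= 1.
Proof.
move=> x01; elim: s => [//|j s /=]; rewrite S1E => /andP[h1 h2].
have [d0 d1] := stable_supp Hmu j; have r0 := rho_gt0 w.
have : rho w * Sw s x <= rho w by rewrite ler_piMr// ltW.
have : 0 <= rho w * Sw s x by rewrite mulr_ge0// ltW.
by move=> ? ?; apply/andP; split; lra.
Qed.

Lemma Sw_cover n x : 0 <= x <= 1 ->
  exists2 s, size s = n & Sw s 0 <= x <= @Sw R w s 1.
Proof.
elim: n x => [|n IH] x x01; first by exists [::].
have [j /andP[h1 h2]] := cover_supp Hmu x01; have r0 := rho_gt0 w.
have [|s sn /andP[s1 s2]] := IH ((x - d j) / rho w).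
  by rewrite ler_pdivlMr// ler_pdivrMr//; apply/andP; split; lra.
exists (j :: s) => /=; first by rewrite sn.
move: s1 s2; rewrite !S1E ler_pdivlMr// ler_pdivrMr// => s1 s2.
by apply/andP; split; lra.
Qed.

Lemma isend_01 n h : isend n h -> 0 <= h <= 1.
Proof. by case=> s _ [] ->; apply: Sw_01; rewrite lexx ler01. Qed.

Lemma net_01 n D : D \in net w n -> 0 <= D.1 /\ D.2 <= 1.
Proof. by move/netP => [/isend_01/andP[? _] /isend_01/andP[_ ?] _ _]. Qed.

(** As d_0 = 0 and d_m = 1 - rho, appending the first letter keeps the left end of a word interval,
    and appending the last letter keeps the right end. *)
Lemma isendS n h : isend n h -> isend n.+1 h.
Proof.
case=> s sn [] ->.
  exists (rcons s ord0); first by rewrite size_rcons sn.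
  by left; rewrite Sw_rcons S1E (d_first Hmu) mulr0 addr0.
exists (rcons s ord_max); first by rewrite size_rcons sn.
by right; rewrite Sw_rcons S1E (d_last Hmu) mulr1 subrKC.
Qed.

Lemma isend_le n k h : (n <= k)%N -> isend n h -> isend k h.
Proof.
move=> /subnKC <-; elim: (k - n)%N => [|i IH]; first by rewrite addn0.
by rewrite addnS => /IH/isendS.
Qed.

(** No endpoint of level n lies inside a net interval of level n, so one interior point decides
    whether a word interval covers all of it. *)
Lemma cov_mid n D s x : D \in net w n -> size s = n ->
  D.1 < x -> x < D.2 -> Sw s 0 <= x -> x <= Sw s 1 -> cov s D.
Proof.
move=> /netP[_ _ _ h] sn x1 x2 s1 s2; apply/andP; split => /=.
  by case: (h (Sw s 0)); [exists s => //; left| |lra].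
by case: (h (Sw s 1)); [exists s => //; right|lra| ].
Qed.

Lemma net_mid n D : D \in net w n -> D.1 < (D.1 + D.2) / 2 /\ (D.1 + D.2) / 2 < D.2.
Proof. by move=> /net_lt ?; split; lra. Qed.

Lemma net_cov n D : D \in net w n -> exists2 s, size s = n & cov s D.
Proof.
move=> Dn; have [m1 m2] := net_mid Dn; have [D0 D1] := net_01 Dn.
have [|s sn /andP[s1 s2]] := @Sw_cover n ((D.1 + D.2) / 2).
  by apply/andP; split; lra.
by exists s => //; exact: (cov_mid Dn sn m1 m2).
Qed.

Lemma Sw1_sub s : @Sw R w s 1 = Sw s 0 + rho w ^+ size s.
Proof. by rewrite SwE mulr1. Qed.

Lemma net_len n D : D \in net w n -> D.2 - D.1 <= rho w ^+ n.
Proof.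
by move=> /net_cov[s sn /andP[/=]]; rewrite Sw1_sub sn; lra.
Qed.

Lemma net_eq n D E x : D \in net w n -> E \in net w n ->
  D.1 < x -> x < D.2 -> E.1 < x -> x < E.2 -> D = E.
Proof.
move=> /netP[D1 D2 _ hD] /netP[E1 E2 _ hE] *.
have e1 : D.1 = E.1.
  by apply/le_anti/andP; split; [case: (hE _ D1)|case: (hD _ E1)]; lra.
have e2 : D.2 = E.2.
  by apply/le_anti/andP; split; [case: (hD _ E2)|case: (hE _ D2)]; lra.
by rewrite (surjective_pairing D) (surjective_pairing E) e1 e2.
Qed.

Lemma subintervP (D E : interv R) : subinterv D E -> E.1 <= D.1 /\ D.2 <= E.2.
Proof. by move=> /andP. Qed.

Lemma subinterv_trans (D E F : interv R) : subinterv D E -> subinterv E F -> subinterv D F.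
Proof.
by move=> /subintervP[? ?] /subintervP[? ?]; apply/andP; split; lra.
Qed.

Lemma sub_net_eq n D E X : D \in net w n -> E \in net w n ->
  X.1 < X.2 -> subinterv X D -> subinterv X E -> D = E.
Proof.
move=> Dn En X12 /subintervP[? ?] /subintervP[? ?].
by apply: (@net_eq n D E ((X.1 + X.2) / 2)) => //; lra.
Qed.

Lemma parentE n E D : is_child w n E D -> parent w n D = E.
Proof.
case/and3P => En Dn DE; rewrite /parent.
case h: [seq _ <- _ | _] => [|F r] /=.
  by have := mem_filter (subinterv D) E (net w n); rewrite h En DE.
have : F \in F :: r by rewrite mem_head.
rewrite -h mem_filter => /andP[DF Fn].
exact: sub_net_eq Fn En (net_lt Dn) DF DE.
Qed.

(** The midpoint of D is interior to E and lies in the interval of s, which contains that of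
    [rcons s l]; [cov_mid] does the rest. *)
Lemma cov_parent n s l E D : size s = n -> is_child w n E D ->
  cov (rcons s l) D -> cov s E.
Proof.
move=> sn /and3P[En Dn /subintervP[h1 h2]] /andP[/=].
have [m1 m2] := net_mid Dn.
have [e1 /andP[_ e2]] : True /\ 0 <= @S1 R w l 0 <= 1.
  by split => //; apply: (@Sw_01 [:: l]); rewrite lexx ler01.
have /andP[_ e3] : 0 <= @S1 R w l 1 <= 1.
  by apply: (@Sw_01 [:: l]); rewrite lexx ler01.
have /andP[e4 _] : 0 <= @S1 R w l 0 <= 1.
  by apply: (@Sw_01 [:: l]); rewrite lexx ler01.
rewrite !Sw_rcons (SwE s (S1 l 0)) (SwE s (S1 l 1)) sn => c1 c2.
have r0 := rhoX_gt0 w n.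
have : rho w ^+ n * S1 l 1 <= rho w ^+ n by rewrite ler_piMr// ltW.
have : 0 <= rho w ^+ n * S1 l 0 by rewrite mulr_ge0// ltW.
move=> ? ?; apply: (cov_mid En sn (x := (D.1 + D.2) / 2)); rewrite ?Sw1_sub ?sn; lra.
Qed.

Lemma mem_Vn n D v : v \in Vn w n D <->
  exists s, [/\ size s = n, cov s D & v = rho w ^- n * (D.1 - Sw s 0)].
Proof.
rewrite mem_sort mem_undup; split.
  move=> /mapP[s]; rewrite mem_filter => /andP[c _] ->.
  by exists s; rewrite size_tuple.
move=> [s [/eqP sn c ->]]; apply/mapP; exists (Tuple sn) => //.
by rewrite mem_filter mem_enum andbT.
Qed.

Lemma Vn_uniq n D : uniq (Vn w n D).
Proof. by rewrite sort_uniq undup_uniq. Qed.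

Lemma Vn_eq n n' D D' : Vn w n D =i Vn w n' D' -> Vn w n D = Vn w n' D'.
Proof.
apply: (irr_sorted_eq lt_trans (@ltxx _ _));
  by rewrite sort_lt_sorted undup_uniq.
Qed.

End Nets.

(** * Rescaling between net intervals with the same characteristic vector *)

Section Transport.
Variables (R : realType) (w : wifs R) (mu : probability (measurableTypeR R) R).
Hypothesis Hmu : standard_assumptions w mu.

(** The affine map of ratio rho^(n' - n) that sends the left end of E to the left end of E'. *)
Definition rescale n (E : interv R) n' (E' : interv R) (x : R) : R :=
  E'.1 + rho w ^+ n' * (rho w ^- n * (x - E.1)).

Definition rescale_itv n E n' E' (D : interv R) : interv R :=
  (rescale n E n' E' D.1, rescale n E n' E' D.2).

(** Characteristic vectors compared without [rn]: length and neighbours alone determine what lies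
    below a net interval. *)
Definition same_shape n (E : interv R) n' (E' : interv R) :=
  [/\ E \in net w n, E' \in net w n', ell w n E = ell w n' E'
    & Vn w n E = Vn w n' E'].

Lemma same_shapeC n E n' E' : same_shape n E n' E' -> same_shape n' E' n E.
Proof. by case. Qed.

Lemma rescaleK n E n' E' x : rescale n' E' n E (rescale n E n' E' x) = x.
Proof.
rewrite /rescale addrAC subrr add0r mulKf ?rhoX_neq0// mulVKf ?rhoX_neq0//.
by rewrite subrKC.
Qed.

Lemma rescale_itvK n E n' E' D :
  rescale_itv n' E' n E (rescale_itv n E n' E' D) = D.
Proof. by rewrite /rescale_itv /= !rescaleK -surjective_pairing. Qed.

Lemma ler_rescale n E n' E' x y :
  (rescale n E n' E' x <= rescale n E n' E' y) = (x <= y).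
Proof.
by rewrite lerD2l ler_pM2l ?rhoX_gt0// ler_pM2l ?invr_gt0 ?rhoX_gt0// lerD2r.
Qed.

Lemma ltr_rescale n E n' E' x y :
  (rescale n E n' E' x < rescale n E n' E' y) = (x < y).
Proof. by rewrite !ltNge ler_rescale. Qed.

Lemma rescale1 n E n' E' : rescale n E n' E' E.1 = E'.1.
Proof. by rewrite /rescale subrr !mulr0 addr0. Qed.

Lemma rescale2 n E n' E' : same_shape n E n' E' -> rescale n E n' E' E.2 = E'.2.
Proof.
case=> _ _; rewrite /ell /rescale => -> _.
by rewrite mulVKf ?rhoX_neq0// subrKC.
Qed.

(** Equality of the neighbour lists pairs each word covering E with a word covering E' at the same
    relative offset. *)
Lemma rescale_word n E n' E' s : same_shape n E n' E' -> size s = n ->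
  cov s E -> exists s' : seq (alphabet w), [/\ size s' = n', cov s' E'
    & forall x, rescale n E n' E' (@Sw R w s x) = Sw s' x].
Proof.
move=> [En En' _ V] sn c.
have : rho w ^- n * (E.1 - Sw s 0) \in Vn w n E by apply/mem_Vn; exists s.
rewrite V => /mem_Vn[s' [sn' c' e]]; exists s'; split => // x.
rewrite (SwE s) (SwE s') sn sn' /rescale.
have -> : rho w ^- n * (Sw s 0 + rho w ^+ n * x - E.1)
        = - (rho w ^- n' * (E'.1 - Sw s' 0)) + x.
  by rewrite -e; have := rhoX_neq0 w n => ?; field.
by have := rhoX_neq0 w n' => ?; field.
Qed.

Lemma S1_01 (l : alphabet w) (t : R) : 0 <= t <= 1 -> 0 <= S1 l t <= 1.
Proof. exact: (Sw_01 Hmu [:: l]). Qed.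

Lemma Sw_in s x : 0 <= x <= 1 -> Sw s 0 <= @Sw R w s x <= Sw s 1.
Proof.
move=> /andP[x0 x1]; rewrite (SwE s x) Sw1_sub.
have r0 := rhoX_gt0 w (size s).
have : rho w ^+ size s * x <= rho w ^+ size s by rewrite ler_piMr// ltW.
have : 0 <= rho w ^+ size s * x by rewrite mulr_ge0// ltW.
by move=> *; apply/andP; split; lra.
Qed.

Lemma isend_rcons n h : isend w n.+1 h -> exists (s : seq (alphabet w)) l t,
  [/\ size s = n, 0 <= t <= 1, t = 0 \/ t = 1 & h = @Sw R w (rcons s l) t].
Proof.
case; case/lastP => [//|s l]; rewrite size_rcons => -[sn] [] ->.
  by exists s, l, 0; split; rewrite ?lexx ?ler01//; left.
by exists s, l, 1; split; rewrite ?lexx ?ler01//; right.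
Qed.

(** An endpoint of level n + 1 interior to E comes from a word whose prefix of length n covers E;
    replacing the prefix by its partner from [rescale_word] produces the image. The ends of E itself
    persist by [isendS]. *)
Lemma isend_rescale n E n' E' h : same_shape n E n' E' ->
  isend w n.+1 h -> E.1 <= h -> h <= E.2 -> isend w n'.+1 (rescale n E n' E' h).
Proof.
move=> T h1; rewrite le_eqVlt => /orP[/eqP<- _|Eh].
  by rewrite rescale1; apply: (isendS Hmu); case: T => _ /netP[].
rewrite le_eqVlt => /orP[/eqP->|hE].
  by rewrite (rescale2 T); apply: (isendS Hmu); case: T => _ /netP[].
have [s [l [t [sn t01 tv hs]]]] := isend_rcons h1.
have c : cov s E.
  case: (T) => En _ _ _; apply: (cov_mid En sn Eh hE); rewrite hs Sw_rcons;
  by have /andP[] := Sw_in s (S1_01 l t01).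
have [s' [sn' c' e]] := rescale_word T sn c.
exists (rcons s' l); first by rewrite size_rcons sn'.
by rewrite hs Sw_rcons e -Sw_rcons; case: tv => ->; [left|right].
Qed.

(** Next-level endpoints in E and E' correspond in both directions, so an endpoint strictly inside
    the image of D would pull back to one strictly inside D. *)
Lemma child_rescale n E n' E' D : same_shape n E n' E' -> is_child w n E D ->
  is_child w n' E' (rescale_itv n E n' E' D).
Proof.
move=> T /and3P[En Dn /subintervP[h1 h2]]; apply/and3P; split.
- by case: T.
- have /netP[D1 D2 D12 Dh] := Dn; apply/netP; split => /=.
  + by apply: isend_rescale => //; lra.
  + by apply: isend_rescale => //; lra.
  + by rewrite ltr_rescale.
  move=> h hh; apply: contrapT => /not_orP[/negP]; rewrite -ltNge => l1 /negP.
  rewrite -ltNge => l2.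
  have k1 : E'.1 <= h by apply: le_trans (ltW l1); rewrite -(rescale1 n E n') ler_rescale.
  have k2 : h <= E'.2 by apply: le_trans (ltW l2) _; rewrite -(rescale2 T) ler_rescale.
  have := isend_rescale (same_shapeC T) hh k1 k2.
  move=> /Dh[]; rewrite -(ler_rescale n E n' E') rescaleK; lra.
- rewrite /subinterv /= -(rescale1 n E n' E') -(rescale2 T).
  by rewrite !ler_rescale h1.
Qed.

Lemma ell_rescale n E n' E' D :
  ell w n'.+1 (rescale_itv n E n' E' D) = ell w n.+1 D.
Proof.
rewrite /ell /rescale_itv/= /rescale !exprS.
have ? := rhoX_neq0 w n; have ? := rhoX_neq0 w n'.
have ? : rho w != 0 by rewrite gt_eqF// rho_gt0.
by field; do !(apply/andP; split).
Qed.

Lemma sub_Vn_rescale n E n' E' D : same_shape n E n' E' -> is_child w n E D ->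
  {subset Vn w n.+1 D <= Vn w n'.+1 (rescale_itv n E n' E' D)}.
Proof.
move=> T ch v /mem_Vn[]; case/lastP => [[]//|s l].
rewrite size_rcons => -[[sn] c ->].
have [s' [sn' c' e]] := rescale_word T sn (cov_parent Hmu sn ch c).
apply/mem_Vn; exists (rcons s' l); split.
- by rewrite size_rcons sn'.
- move: c => /subintervP[]; rewrite /cov /subinterv /= !Sw_rcons -!e !ler_rescale.
  by move=> -> ->.
rewrite !Sw_rcons -e /rescale_itv/= /rescale !exprS.
have ? := rhoX_neq0 w n; have ? := rhoX_neq0 w n'.
have ? : rho w != 0 by rewrite gt_eqF// rho_gt0.
by field; do !(apply/andP; split).
Qed.

Lemma Vn_rescale n E n' E' D : same_shape n E n' E' -> is_child w n E D ->
  Vn w n'.+1 (rescale_itv n E n' E' D) = Vn w n.+1 D.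
Proof.
move=> T ch; apply: Vn_eq => v; apply/idP/idP; last exact: sub_Vn_rescale.
move=> /(sub_Vn_rescale (same_shapeC T) (child_rescale T ch)).
by rewrite rescale_itvK.
Qed.

(** Rescaling is increasing and preserves length and neighbours, hence carries the ordered list of
    like siblings below E onto that below E'; positions are kept. *)
Lemma rn_rescale n E n' E' D : same_shape n E n' E' -> is_child w n E D ->
  rn w n'.+1 (rescale_itv n E n' E' D) = rn w n.+1 D.
Proof.
move=> T ch; have ch' := child_rescale T ch.
rewrite /rn (parentE ch) (parentE ch') ell_rescale (Vn_rescale T ch).
set L := [seq _ <- _ | _]; set L' := [seq _ <- _ | _].
suff <- : map (rescale_itv n E n' E') L' = L.
  by rewrite index_map// => x y /(congr1 (rescale_itv n' E' n E)); rewrite !rescale_itvK.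
have tr : transitive (fun D E : interv R => D.2 < E.2).
  by move=> x y z; exact: lt_trans.
apply: (irr_sorted_eq tr); first by move=> x; exact: ltxx.
- rewrite sorted_map; apply: (sub_sorted (e := fun D E : interv R => D.2 < E.2)).
    by move=> x y /=; rewrite ltr_rescale.
  by apply: sorted_filter; [exact: tr|exact: sorted_net].
- by apply: sorted_filter; [exact: tr|exact: sorted_net].
move=> x; apply/mapP/idP => [[y]|].
  rewrite !mem_filter => /andP[/and3P[c1 /eqP c2 /eqP c3] yn ->].
  have c1' := child_rescale T c1; rewrite c1' ell_rescale c2 (Vn_rescale T c1) c3.
  by rewrite !eqxx/=; case/and3P: c1'.
rewrite mem_filter => /andP[/and3P[c1 /eqP c2 /eqP c3] xn].
have T' := same_shapeC T; have c1' := child_rescale T' c1.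
exists (rescale_itv n' E' n E x); last by rewrite rescale_itvK.
rewrite mem_filter c1' ell_rescale c2 (Vn_rescale T' c1) c3 !eqxx/=.
by case/and3P: c1'.
Qed.

Lemma charvec_rescale n E n' E' D : same_shape n E n' E' -> is_child w n E D ->
  charvec w n'.+1 (rescale_itv n E n' E' D) = charvec w n.+1 D.
Proof.
by move=> T ch; rewrite /charvec ell_rescale (Vn_rescale T ch) (rn_rescale T ch).
Qed.

Lemma charvec_same_shape n E n' E' : E \in net w n -> E' \in net w n' ->
  charvec w n E = charvec w n' E' -> same_shape n E n' E'.
Proof. by move=> ? ? [e1 e2 _]; split. Qed.

(** This is the purpose of the third component [rn]: both children occupy the same position in one
    list of like siblings. *)
Lemma child_unique n E D D' : is_child w n E D -> is_child w n E D' ->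
  charvec w n.+1 D = charvec w n.+1 D' -> D = D'.
Proof.
move=> c c' [el V]; rewrite /rn (parentE c) (parentE c') el V => -[e].
set L := [seq _ <- _ | _] in e.
have DL : D \in L by rewrite mem_filter c el V !eqxx; case/and3P: c.
have DL' : D' \in L by rewrite mem_filter c' !eqxx; case/and3P: c'.
by rewrite -(nth_index (0, 0) DL) e nth_index.
Qed.

(** Any parent/child pair that realizes the edge from a to b can be rescaled so that its parent
    becomes E. *)
Lemma child_ex n E a b : E \in net w n -> charvec w n E = a -> child w a b ->
  exists2 D, is_child w n E D & charvec w n.+1 D = b.
Proof.
move=> En <- /asboolP[[[n' E'] D'] [ch e1 ->]].
have T : same_shape n' E' n E.
  by apply: charvec_same_shape => //; case/and3P: ch.
by exists (rescale_itv n' E' n E D'); [exact: child_rescale|exact: charvec_rescale].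
Qed.

Lemma child_offset n E D n' E' D' : is_child w n E D -> is_child w n' E' D' ->
  charvec w n E = charvec w n' E' -> charvec w n.+1 D = charvec w n'.+1 D' ->
  D' = rescale_itv n E n' E' D.
Proof.
move=> ch ch' e1 e2.
have T : same_shape n E n' E'.
  by apply: charvec_same_shape => //; [case/and3P: ch|case/and3P: ch'].
apply: (child_unique ch') (child_rescale T ch) _.
by rewrite (charvec_rescale T ch) e2.
Qed.

(** The equation that selects the letter is invariant under rescaling, so the realizing pair chosen
    in [Tmat1] is immaterial. *)
Lemma trans_entry_type n E D n' E' D' x y :
  is_child w n E D -> is_child w n' E' D' ->
  charvec w n E = charvec w n' E' -> charvec w n.+1 D = charvec w n'.+1 D' ->
  trans_entry w n E D x y = trans_entry w n' E' D' x y.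
Proof.
move=> ch ch' e1 e2; rewrite (child_offset ch ch' e1 e2) /trans_entry.
congr (if _ is Some l then _ else _); apply: eq_pick => l.
rewrite /rescale_itv /= /rescale !exprS.
have ? := rhoX_neq0 w n; have ? := rhoX_neq0 w n'.
have ? : rho w != 0 by rewrite gt_eqF// rho_gt0.
apply/eqP/eqP => e.
  by rewrite (_ : D.1 = E.1 - rho w ^+ n * x + rho w ^+ n * d l + rho w * rho w ^+ n * y);
    [field|rewrite e; ring].
have -> : D.1 = E.1 + rho w ^+ n * (rho w ^- n' * (rho w ^+ n' * (rho w ^- n * (D.1 - E.1)))) by field; apply/andP.
rewrite (_ : rho w ^+ n' * (rho w ^- n * (D.1 - E.1))
  = - rho w ^+ n' * x + rho w ^+ n' * d l + rho w * rho w ^+ n' * y); first by field.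
by lra.
Qed.

End Transport.

(** * Comparison of Q(D) with mu(D), and finiteness of relative positions *)

Section CoverMass.
Variables (R : realType) (w : wifs R) (mu : probability (measurableTypeR R) R).
Hypothesis Hmu : standard_assumptions w mu.

(** This is the quantity Q(D). *)
Definition cover_mass n (D : interv R) : R := wsum n (fun s : seq (alphabet w) => (cov s D)%:R).

Lemma cover_mass_gt0 n D : D \in net w n -> 0 < cover_mass n D.
Proof.
move=> /(net_cov Hmu)[s sn c]; apply: (wsum_gt0 (t := s)) => //.
by rewrite c ltr01.
Qed.

Lemma p_first_le (j : alphabet w) : p (@ord0 (msize w)) <= p j.
Proof. by case: Hmu => _ _ []. Qed.

Lemma cover_mass_child_le n E D : is_child w n E D ->
  cover_mass n.+1 D <= cover_mass n E.
Proof.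
move=> ch; rewrite /cover_mass /=; apply: ler_wsum => s sn.
case: (boolP (cov s E)) => cE.
  apply: (@le_trans _ _ (\sum_(l : alphabet w) p l)); last by rewrite p_sum1.
  apply: ler_sum => l _.
  by case: (cov _ _); rewrite ?mulr1 ?mulr0 ?p_ge0.
rewrite big1// => l _; case: (boolP (cov (rcons s l) D)) => cD; last by rewrite mulr0.
by rewrite (cov_parent Hmu sn ch cD) in cE.
Qed.

Lemma cov_child n E D (s : seq (alphabet w)) : is_child w n E D -> size s = n -> cov s E ->
  exists l : alphabet w, cov (rcons s l) D.
Proof.
move=> /and3P[_ Dn /subintervP[h1 h2]] sn /subintervP/=; rewrite Sw1_sub sn => -[c1 c2].
have [m1 m2] := net_mid Dn; set t := (D.1 + D.2) / 2 in m1 m2.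
have r0 := rhoX_gt0 w n.
have [|l /andP[l1 l2]] := cover_supp Hmu (x := (t - Sw s 0) / rho w ^+ n).
  by rewrite ler_pdivlMr// ler_pdivrMr//; apply/andP; split; lra.
move: l1 l2; rewrite ler_pdivlMr// ler_pdivrMr// => l1 l2.
exists l; apply: (cov_mid Dn _ m1 m2); rewrite ?size_rcons ?sn// Sw_rcons S1E.
  by rewrite SwE sn mulr0 add0r; lra.
by rewrite SwE sn mulr1; lra.
Qed.

(** Every word covering E extends by some letter to a word covering D, and each letter has weight at
    least p_0. *)
Lemma cover_mass_child_ge n E D : is_child w n E D ->
  p (@ord0 (msize w)) * cover_mass n E <= cover_mass n.+1 D.
Proof.
move=> ch; rewrite /cover_mass -wsumZ /=; apply: ler_wsum => s sn.
case: (boolP (cov s E)) => cE; last first.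
  by rewrite mulr0; apply: sumr_ge0 => l _; rewrite mulr_ge0 ?p_ge0.
have [l cl] := cov_child ch sn cE.
rewrite (bigD1 l)//= cl !mulr1; apply: (le_trans (p_first_le l)).
by rewrite lerDl; apply: sumr_ge0 => i _; rewrite mulr_ge0 ?p_ge0.
Qed.

(** In the expansion [mass_wsum] a word whose interval misses [a, b] contributes 0, and any other
    word at most its weight. *)
Lemma mass_le_wsum n (a b : R) (G : seq (alphabet w) -> bool) :
  (forall s, size s = n -> Sw s 0 <= b -> a <= Sw s 1 -> G s) ->
  mass mu `[a, b]%classic <= wsum n (fun s => (G s)%:R).
Proof.
move=> h; rewrite (mass_wsum Hmu n); apply: ler_wsum => s sn.
case: (boolP (G s)) => Gs; first exact: mass_le1.
rewrite /word_preimage (mass_outside Hmu)// sn.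
have r0 := rhoX_gt0 w n.
case: (lerP (Sw s 0) b) => h1; last first.
  by left; rewrite pmulr_rlt0 ?invr_gt0// subr_lt0.
case: (lerP a (Sw s 1)) => h2; first by rewrite h in Gs.
by right; rewrite mulrC ltr_pdivlMr// mul1r; move: h2; rewrite Sw1_sub sn; lra.
Qed.

(** Since [a, b] is strictly inside D, a word interval meeting [a, b] cannot end inside D and
    therefore covers D. *)
Lemma mass_le_cover n D (a b : R) : D \in net w n -> D.1 < a -> a <= b -> b < D.2 ->
  mass mu `[a, b]%classic <= cover_mass n D.
Proof.
move=> /netP[_ _ _ Dh] h1 h2 h3; apply: mass_le_wsum => s sn s0 s1.
apply/andP; split => /=.
  by case: (Dh (Sw s 0)) => [| |?]; [exists s => //; left| |lra].
by case: (Dh (Sw s 1)) => [|?|]; [exists s => //; right|lra|].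
Qed.

(** Finite type restricts the differences of left ends of overlapping words. A right end is a left
    end plus rho^n, which turns a normalized difference f into 1 - f. *)
Lemma finite_offsets : exists G : seq R, forall n h s, isend w n h ->
  size s = n -> @Sw R w s 0 <= h <= Sw s 1 -> rho w ^- n * (h - Sw s 0) \in G.
Proof.
case: (Hmu) => _ [F [finF F0 ft]] _ _.
have /finite_seqP[F' FE] := finF.
(* Finite type speaks of levels n >= 1 only; 0 is adjoined for the empty word. *)
pose F1 := 0 :: F'; exists (F1 ++ [seq 1 - f | f <- F1]).
have c1 : (1 - rho w)^-1 * (d (@ord_max (msize w)) - d (@ord0 (msize w))) = 1.
  rewrite (d_first Hmu) (d_last Hmu) subr0 mulVf//.
  by rewrite gt_eqF// subr_gt0 rho_lt1.
have key n (s t : seq (alphabet w)) : size s = n -> size t = n ->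
  `|Sw s 0 - Sw t 0| <= rho w ^+ n -> rho w ^- n * `|Sw s 0 - Sw t 0| \in F1.
  case: n => [/size0nil-> /size0nil->|n /eqP sn /eqP tn le1].
    by rewrite subrr normr0 mulr0 mem_head.
  move: (ft n.+1 isT (Tuple sn) (Tuple tn)) => /=; rewrite c1 => -[].
    by rewrite mulrC ltr_pdivlMr ?rhoX_gt0// mul1r; lra.
  by rewrite FE inE => ->; rewrite orbT.
move=> n h s [t tn ht] sn /andP[]; rewrite Sw1_sub sn => h1 h2.
have r0 := rhoX_gt0 w n; have rn := rhoX_neq0 w n.
rewrite mem_cat; case: ht => ht.
  have nn : `|Sw t 0 - Sw s 0| = h - Sw s 0 by rewrite ht ger0_norm//; lra.
  by rewrite -nn key// nn; lra.
have e : Sw t 0 = h - rho w ^+ n by rewrite ht Sw1_sub tn addrK.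
have nn : `|Sw t 0 - Sw s 0| = Sw s 0 - Sw t 0 by rewrite ler0_norm ?opprB//; lra.
apply/orP; right; apply/mapP; exists (rho w ^- n * `|Sw t 0 - Sw s 0|).
  by apply: key => //; rewrite nn; lra.
by rewrite nn e; field.
Qed.

(** The two ends of D, seen from a covering word, take finitely many positions in [0, 1], so a
    function positive on all of them is bounded below by a positive constant. *)
Lemma net_offsets (f : R -> R -> R) :
  (forall u v, 0 <= u -> u < v -> v <= 1 -> 0 < f u v) ->
  exists2 c, 0 < c & forall n D (s : seq (alphabet w)), D \in net w n -> size s = n -> cov s D ->
    c <= f (rho w ^- n * (D.1 - Sw s 0)) (rho w ^- n * (D.2 - Sw s 0)).
Proof.
move=> f0; have [G HG] := finite_offsets.
pose s := [seq z <- [seq (u, v) | u <- G, v <- G] | [&& 0 <= z.1, z.1 < z.2 & z.2 <= 1]].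
have [z|c c0 hc] := @fin_pos_min R _ s (fun z => f z.1 z.2).
  by rewrite mem_filter => /andP[/and3P[? ? ?] _]; exact: f0.
exists c => // n D t Dn tn cD.
have /subintervP/= [h1 h2] := cD.
have /netP[D1 D2 D12 _] := Dn; have r0 := rhoX_gt0 w n.
apply: (hc (rho w ^- n * (D.1 - Sw t 0), rho w ^- n * (D.2 - Sw t 0))).
rewrite mem_filter /=; apply/andP; split.
  apply/and3P; split.
  - by rewrite mulr_ge0 ?invr_ge0 ?(ltW r0)//; lra.
  - by rewrite ltr_pM2l ?invr_gt0// ltrD2r.
  - by rewrite mulrC ler_pdivrMr// mul1r; move: h2; rewrite Sw1_sub tn; lra.
by apply/allpairsP; exists (rho w ^- n * (D.1 - Sw t 0), rho w ^- n * (D.2 - Sw t 0));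
  split => //; apply: HG => //; apply/andP; split; lra.
Qed.

(** Each word covering D contributes its weight times the mass of a nondegenerate subinterval of
    [0, 1], and by [net_offsets] these masses are bounded below. *)
Lemma mass_ge_cover : exists2 c, 0 < c & forall n D, D \in net w n ->
  c * cover_mass n D <= mass mu `[D.1, D.2]%classic.
Proof.
have [u v|c c0 hc] := @net_offsets (fun u v => mass mu `[u, v]%classic).
  exact: (mass_gt0 Hmu).
exists c => // n D Dn; rewrite (mass_wsum Hmu n) /cover_mass -wsumZ.
apply: ler_wsum => s sn; case: (boolP (cov s D)) => cD; last first.
  by rewrite mulr0; exact: mass_ge0.
by rewrite mulr1 /word_preimage sn; exact: hc.
Qed.

Lemma net_len_ge : exists2 c, 0 < c & forall n D, D \in net w n ->
  c * rho w ^+ n <= D.2 - D.1.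
Proof.
have [u v _|c c0 hc] := @net_offsets (fun u v => v - u).
  by rewrite subr_gt0.
exists c => // n D Dn; have [s sn cD] := net_cov Hmu Dn.
have := hc _ _ _ Dn sn cD.
by rewrite -mulrBr [rho w ^- n * _]mulrC ler_pdivlMr ?rhoX_gt0//; lra.
Qed.

Lemma net_right n h h' : isend w n h -> isend w n h' -> h < h' ->
  exists2 b, (h, b) \in net w n & b <= h'.
Proof.
move=> eh eh' hh.
pose s := [seq e <- endpoints w n | h < e].
have h's : h' \in s by rewrite mem_filter hh; apply/mem_endpoints.
have ss : sorted <%R s.
  by apply: sorted_filter; [exact: lt_trans|rewrite sort_lt_sorted undup_uniq].
have bmin : forall z, z \in s -> head 0 s <= z.
  case: (s) ss => [//|b r /= pr] z; rewrite inE => /orP[/eqP->//|zr].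
  by apply/ltW; have /allP := order_path_min lt_trans pr; apply.
have bs : head 0 s \in s by case: (s) h's => [//|b r] _; rewrite mem_head.
exists (head 0 s); last exact: bmin.
move: bs; rewrite mem_filter => /andP[hb /mem_endpoints bn].
apply/netP; split => //= z zn; case: (leP z h) => hz; [by left|right].
by apply: bmin; rewrite mem_filter hz; apply/mem_endpoints.
Qed.

(** Two distinct endpoints of level n have a net interval between them, whose length is at least c
    rho^n. *)
Lemma isend_sep : exists2 c, 0 < c & forall n h h', isend w n h ->
  isend w n h' -> h < h' -> c * rho w ^+ n <= h' - h.
Proof.
have [c c0 hc] := net_len_ge; exists c => // n h h' e e' hh.
by have [b /hc/= ? ?] := net_right e e' hh; lra.
Qed.

End CoverMass.

(** * Mass rows, transition matrices and descent along admissible paths *)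

Section Transition.
Variables (R : realType) (w : wifs R) (mu : probability (measurableTypeR R) R).
Hypothesis Hmu : standard_assumptions w mu.
Local Notation p0 := (@p R w ord0).

(** The part of Q(D) carried by the covering words with neighbour value x; these parts are the
    coordinates of the mass vector of D. *)
Definition nbr_mass n (D : interv R) (x : R) : R :=
  wsum n (fun s : seq (alphabet w) =>
    (cov s D && (D.1 - Sw s 0 == rho w ^+ n * x))%:R).

(** The list V is an argument so that the dimension can be written as [nbr] of a characteristic
    vector, as in the type of [Tmat]. *)
Definition nbr_row (V : seq R) n D : 'rV[R]_(size V) :=
  \row_j nbr_mass n D V`_j.

Lemma cover_mass_nbr n D :
  cover_mass w n D = \sum_j nbr_row (Vn w n D) n D 0 j.
Proof.
under eq_bigr do rewrite mxE.
rewrite -(big_mkord xpredT (fun j => nbr_mass n D (Vn w n D)`_j)) -(big_nth 0 xpredT (nbr_mass n D)).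
rewrite -wsum_sum; apply: eq_wsum => s sn.
case: (boolP (cov s D)) => c; last by rewrite big1.
rewrite (bigD1_seq (rho w ^- n * (D.1 - Sw s 0))) ?Vn_uniq//=; last first.
  by apply/mem_Vn; exists s.
rewrite mulVKf ?rhoX_neq0// eqxx big1 ?addr0// => x /eqP xn.
by case: eqP => // e; case: xn; rewrite e mulKf ?rhoX_neq0.
Qed.

Lemma nbr_mass_ge0 n D x : 0 <= nbr_mass n D x.
Proof. exact: wsum_ge0. Qed.

Lemma nbr_mass_le n D x : nbr_mass n D x <= cover_mass w n D.
Proof.
apply: ler_wsum => s _; case: (cov s D) => //=.
by case: (_ == _); rewrite ?lexx ?ler01.
Qed.

Lemma d_inj (l l' : alphabet w) : d l = d l' -> l = l'.
Proof.
by move=> e; apply/val_inj; case: (ltngtP l l') => // /d_incr; rewrite e ltxx.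
Qed.

(** Word intervals of one level have equal length, so covering D depends only on the left end, hence
    only on the offset. *)
Lemma cov_offset n D y s : y \in Vn w n D -> size s = n ->
  D.1 - @Sw R w s 0 = rho w ^+ n * y -> cov s D.
Proof.
move=> /mem_Vn[t [tn ct ->]] sn; rewrite mulVKf ?rhoX_neq0// => e.
move: ct; rewrite /cov /subinterv /= !Sw1_sub sn tn.
by have -> : Sw s 0 = Sw t 0 by lra.
Qed.

(** A word covering D has a prefix covering E, at a unique offset x. Given x and y, at most one last
    letter fits, namely the one found by [trans_entry]; the factor p_0 undoes the normalization of
    the primitive matrix. *)
Lemma nbr_mass_child n E D y : is_child w n E D -> y \in Vn w n.+1 D ->
  nbr_mass n.+1 D y =
  \sum_(x <- Vn w n E) nbr_mass n E x * (p0 * trans_entry w n E D x y).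
Proof.
move=> ch yV; rewrite /nbr_mass /=.
under [RHS]eq_bigr => x _ do rewrite mulrC -wsumZ.
rewrite -wsum_sum; apply: eq_wsum => s sn.
case: (boolP (cov s E)) => cE; last first.
  rewrite [RHS]big1 => [|x _]; last by rewrite andFb mulr0.
  rewrite big1// => l _.
  case: (boolP (cov (rcons s l) D)) => c; last by rewrite andFb mulr0.
  by rewrite (cov_parent Hmu sn ch c) in cE.
rewrite (bigD1_seq (rho w ^- n * (E.1 - Sw s 0))) ?Vn_uniq//=; last first.
  by apply/mem_Vn; exists s.
rewrite mulVKf ?rhoX_neq0// eqxx mulr1 [X in _ = _ + X]big1 ?addr0; last first.
  move=> x /eqP xn; case: eqP => [e|_]; last by rewrite mulr0.
  by case: xn; rewrite e mulKf ?rhoX_neq0.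
(* The covering condition follows from the offset equation, because y belongs to [Vn w n.+1 D]. *)
have cl l : cov (rcons s l) D && (D.1 - Sw (rcons s l) 0 == rho w ^+ n.+1 * y)
    = (E.1 - rho w ^+ n * (rho w ^- n * (E.1 - Sw s 0)) + rho w ^+ n * d l
       == D.1 - rho w ^+ n.+1 * y).
  rewrite mulVKf ?rhoX_neq0// subKr.
  have e : Sw (rcons s l) 0 = Sw s 0 + rho w ^+ n * d l.
    by rewrite Sw_rcons SwE sn S1E mulr0 add0r.
  apply/andP/eqP => [[_ /eqP]|h]; first by rewrite e; lra.
  have h' : D.1 - Sw (rcons s l) 0 = rho w ^+ n.+1 * y by rewrite e; lra.
  split; last exact/eqP.
  by apply: (cov_offset yV _ h'); rewrite size_rcons sn.
under eq_bigr => l _ do rewrite cl.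
rewrite /trans_entry; case: pickP => [l hl|hl]; last first.
  by rewrite mulr0 big1// => l _; rewrite hl mulr0.
have pn : p0 != 0 by rewrite gt_eqF// p_gt0.
rewrite [RHS]mulVKf// (bigD1 l)//= hl mulr1 big1 ?addr0// => l' ll'.
case: eqP => [e|]; last by rewrite mulr0.
case/eqP: ll'; apply: d_inj; move/eqP: hl; rewrite -e.
by move=> /addrI/(mulfI (rhoX_neq0 w n)).
Qed.

Lemma Tmat1E n E D (j : 'I_(size (Vn w n E))) (k : 'I_(size (Vn w n.+1 D))) :
  is_child w n E D ->
  Tmat1 w (charvec w n E) (charvec w n.+1 D) j k
  = trans_entry w n E D (Vn w n E)`_j (Vn w n.+1 D)`_k.
Proof.
move=> ch; rewrite /Tmat1; case: xgetP => [[[n' E'] D'] _|]; last first.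
  by move=> /(_ (n, E, D)) []; split.
move=> [ch' e1 e2]; rewrite mxE.
exact: (trans_entry_type Hmu _ _ ch' ch (esym e1) (esym e2)).
Qed.

Lemma nbr_row_child n E D : is_child w n E D ->
  nbr_row (nbr (charvec w n.+1 D)) n.+1 D =
  p0 *: (nbr_row (nbr (charvec w n E)) n E
         *m Tmat1 w (charvec w n E) (charvec w n.+1 D)).
Proof.
move=> ch; apply/rowP => k; rewrite !mxE (nbr_mass_child ch); last exact: mem_nth.
rewrite (big_nth 0) big_mkord big_distrr/=; apply: eq_bigr => j _.
by rewrite mxE (Tmat1E _ _ ch) mulrCA.
Qed.

Lemma trans_entry_ge0 n E D x y : 0 <= trans_entry w n E D x y.
Proof.
rewrite /trans_entry; case: pickP => [l _|_] //.
by rewrite mulr_ge0 ?invr_ge0 ?p_ge0.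
Qed.

Lemma Tmat_ge0 a s i j : 0 <= Tmat w a s i j.
Proof.
elim: s a i j => [|b s IH] a i j /=; first by rewrite mxE ler0n.
rewrite mxE; apply: sumr_ge0 => k _; rewrite mulr_ge0//.
by rewrite /Tmat1; case: xget => [[n E] D]; rewrite mxE trans_entry_ge0.
Qed.

(** The net interval reached from D along the path s. For an admissible path the filtered list
    contains exactly the required child at each step, so the default D of [head] is not reached. *)
Fixpoint desc n (D : interv R) (s : seq (cvec R)) : interv R :=
  if s is b :: s' then
    desc n.+1 (head D [seq F <- net w n.+1 |
                        subinterv F D && (charvec w n.+1 F == b)]) s'
  else D.

Lemma desc_cons n D b s : D \in net w n -> child w (charvec w n D) b ->
  exists F, [/\ is_child w n D F, charvec w n.+1 F = b
    & desc n D (b :: s) = desc n.+1 F s].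
Proof.
move=> Dn /(child_ex Hmu Dn erefl)[F chF Fb].
have : F \in [seq F <- net w n.+1 | subinterv F D && (charvec w n.+1 F == b)].
  by rewrite mem_filter Fb eqxx andbT andbC; case/and3P: chF => _ -> ->.
rewrite [desc _ _ _]/=; case h: [seq _ <- _ | _] => [//|G r] _.
have : G \in G :: r by rewrite mem_head.
rewrite -h mem_filter => /andP[/andP[GD /eqP Gb] Gn].
exists G; split; [by apply/and3P|exact: Gb|].
exact: (congr1 (fun r => desc n.+1 (head D r) s) h).
Qed.

Lemma descP n D s : D \in net w n -> path (child w) (charvec w n D) s ->
  [/\ desc n D s \in net w (n + size s), subinterv (desc n D s) D &
      charvec w (n + size s) (desc n D s) = last (charvec w n D) s].
Proof.
elim: s n D => [|b s IH] n D Dn.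
  by move=> _; rewrite addn0; split => //; apply/andP.
rewrite [path _ _ _]/= => /andP[cb pb]; have [F [ch Fb ->]] := desc_cons s Dn cb.
have /and3P[_ Fn FD] := ch; rewrite -Fb in pb; have [h1 h2 h3] := IH _ _ Fn pb.
rewrite -addSnnS; split; rewrite ?h3 ?Fb//.
exact: subinterv_trans h2 FD.
Qed.

Lemma desc_cat n D s t : desc n D (s ++ t) = desc (n + size s) (desc n D s) t.
Proof.
by elim: s n D => [|b s IH] n D /=; rewrite ?addn0// IH addSnnS.
Qed.

Lemma nbr_row_desc n D a s : D \in net w n -> charvec w n D = a ->
  path (child w) a s ->
  nbr_row (nbr (last a s)) (n + size s) (desc n D s)
  = p0 ^+ size s *: (nbr_row (nbr a) n D *m Tmat w a s).
Proof.
elim: s n D a => [|b s IH] n D a Dn Da; rewrite -{1}Da.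
  by move=> _; rewrite addn0 expr0 scale1r mulmx1.
rewrite [path _ _ _]/= => /andP[cb pb]; have [F [ch Fb ->]] := desc_cons s Dn cb.
have /and3P[_ Fn FD] := ch.
rewrite -addSnnS (IH _ _ _ Fn Fb pb) -Fb -Da (nbr_row_child ch).
by rewrite -scalemxAl scalerA exprSr mulmxA.
Qed.

Lemma cover_mass_desc_le n D s : D \in net w n ->
  path (child w) (charvec w n D) s ->
  cover_mass w (n + size s) (desc n D s) <= cover_mass w n D.
Proof.
elim: s n D => [|b s IH] n D Dn; first by rewrite addn0.
rewrite [path _ _ _]/= => /andP[cb pb]; have [F [ch Fb ->]] := desc_cons s Dn cb.
have /and3P[_ Fn FD] := ch; rewrite -Fb in pb.
rewrite -addSnnS; apply: le_trans (IH _ _ Fn pb) _.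
exact: cover_mass_child_le Hmu _ _ _ ch.
Qed.

Lemma cover_mass_desc_ge n D s : D \in net w n ->
  path (child w) (charvec w n D) s ->
  p0 ^+ size s * cover_mass w n D <= cover_mass w (n + size s) (desc n D s).
Proof.
elim: s n D => [|b s IH] n D Dn; first by rewrite addn0 mul1r.
rewrite [path _ _ _]/= => /andP[cb pb]; have [F [ch Fb ->]] := desc_cons s Dn cb.
have /and3P[_ Fn FD] := ch; rewrite -Fb in pb.
rewrite -addSnnS; apply: le_trans (IH _ _ Fn pb).
rewrite exprSr -mulrA ler_pM2l ?exprn_gt0 ?p_gt0//.
exact: cover_mass_child_ge Hmu _ _ _ ch.
Qed.

(* Every coordinate of the row at the end of the positive path is comparable
   with the total mass at its start, whatever the distribution there. *)
Lemma cover_mass_distortion a s1 : path (child w) a s1 ->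
  positive_mx (Tmat w a s1) ->
  exists2 k, 0 < k & forall s2, path (child w) (last a s1) s2 ->
  forall n D n' D', D \in net w n -> charvec w n D = a ->
    D' \in net w n' -> charvec w n' D' = a ->
    k * cover_mass w (n + size (s1 ++ s2)) (desc n D (s1 ++ s2)) * cover_mass w n' D'
    <= cover_mass w (n' + size (s1 ++ s2)) (desc n' D' (s1 ++ s2)) * cover_mass w n D.
Proof.
move=> pa pos.
have [z _|e e0 he] := @fin_pos_min R _ (enum {: 'I_(size (nbr a)) * 'I_(size (nbr (last a s1)))})
    (fun z => Tmat w a s1 z.1 z.2); first exact: pos.
exists (p0 ^+ size s1 * e); first by rewrite mulr_gt0// exprn_gt0// p_gt0.
move=> s2 pb n D n' D' Dn Da Dn' Da'.
(* The final Q is a fixed nonnegative linear form in the row at the end of s1, and every coordinate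
   of that row lies between p_0^|s1| e Q(F) and Q(F). Applying this to D and D' compares them term
   by term. *)
have tot m F : F \in net w m -> charvec w m F = a ->
  let G := desc m F s1 in
  [/\ cover_mass w (m + size (s1 ++ s2)) (desc m F (s1 ++ s2)) =
      p0 ^+ size s2 * \sum_k \sum_j nbr_row (nbr (last a s1)) (m + size s1) G 0 j
        * Tmat w (last a s1) s2 j k,
     forall j, nbr_row (nbr (last a s1)) (m + size s1) G 0 j <= cover_mass w m F &
     forall j, p0 ^+ size s1 * e * cover_mass w m F
       <= nbr_row (nbr (last a s1)) (m + size s1) G 0 j].
  move=> Fm Fa G; rewrite -Fa in pa; have [Gn GF Ga] := descP Fm pa; rewrite Fa in Ga pa.
  split.
  - have pb' : path (child w) (charvec w (m + size s1) G) s2 by rewrite Ga.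
    have [Hn _ Ha] := descP Gn pb'.
    rewrite desc_cat size_cat addnA cover_mass_nbr.
    have -> : Vn w (m + size s1 + size s2) (desc (m + size s1) G s2)
       = nbr (last (last a s1) s2) by rewrite -Ga -Ha.
    rewrite (nbr_row_desc Gn Ga pb) big_distrr/=; apply: eq_bigr => k _.
    by rewrite !mxE.
  - move=> j; rewrite mxE; apply: le_trans (nbr_mass_le _ _ _) _.
    by apply: cover_mass_desc_le => //; rewrite Fa.
  - move=> j; rewrite (nbr_row_desc Fm Fa pa) mxE -mulrA ler_pM2l ?exprn_gt0 ?p_gt0//.
    have VE : Vn w m F = nbr a by rewrite -Fa.
    rewrite cover_mass_nbr VE mxE big_distrr/=; apply: ler_sum => i _.
    rewrite mulrC ler_wpM2l//; first by rewrite mxE nbr_mass_ge0.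
    exact: (he (i, j) (mem_enum _ _)).
have [q1 q2 _] := tot _ _ Dn Da; have [q1' _ q3'] := tot _ _ Dn' Da'.
rewrite q1 q1'.
set A := \sum_k _; set B := \sum_k _; set c := p0 ^+ size s1 * e.
rewrite [leLHS](_ : _ = p0 ^+ size s2 * (A * (c * cover_mass w n' D'))); last by ring.
rewrite -[leRHS]mulrA ler_pM2l ?exprn_gt0 ?p_gt0// /A /B !big_distrl/=.
apply: ler_sum => k _; rewrite !big_distrl/=; apply: ler_sum => j _.
rewrite mulrAC [leRHS]mulrAC; apply: ler_wpM2r; first exact: Tmat_ge0.
rewrite mulrC; apply: ler_pM => //.
  apply: mulr_ge0; first by rewrite mulr_ge0 ?(ltW e0) ?exprn_ge0 ?p_ge0.
  exact/ltW/(cover_mass_gt0 Hmu).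
by rewrite mxE nbr_mass_ge0.
Qed.

End Transition.

(** * Exponential growth rate of Q along a repeated positive cycle *)

Section Growth.
Variables (R : realType) (w : wifs R) (mu : probability (measurableTypeR R) R).
Hypothesis Hmu : standard_assumptions w mu.
Local Notation p0 := (@p R w ord0).

(** Estimating b at (m+1)(n+1) in two ways shows that every (b(n+1) - K)/(n+1) lies below every
    (b(m+1) + K)/(m+1); lam is the supremum of the former. *)
Lemma quasi_additive (b : nat -> R) K :
  (forall i j, `|b (i + j)%N - b i - b j| <= K) ->
  exists lam, forall i, `|b i - i%:R * lam| <= K.
Proof.
move=> hb.
have mul m n : `|b (m.+1 * n)%N - m.+1%:R * b n| <= m%:R * K.
  elim: m => [|m IH]; first by rewrite mul1n mul1r mul0r subrr normr0.
  have := hb n (m.+1 * n)%N; rewrite -mulSn.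
  move: IH; rewrite !ler_norml -(natr1 m.+1) -(natr1 m) !mulrDl !mul1r.
  by move=> /andP[? ?] /andP[? ?]; apply/andP; split; lra.
have K0 : 0 <= K by apply: le_trans (hb 0%N 0%N).
have cross m n : (b n.+1 - K) / n.+1%:R <= (b m.+1 + K) / m.+1%:R.
  rewrite ler_pdivrMr ?ltr0n// mulrAC ler_pdivlMr ?ltr0n//.
  have := mul m n.+1; have := mul n m.+1; rewrite mulnC.
  rewrite !ler_norml -(natr1 m) -(natr1 n).
  by move=> /andP[? ?] /andP[? ?]; lra.
pose S := [set y | exists n, y = (b n.+1 - K) / n.+1%:R].
have S0 : S !=set0 by exists ((b 1%N - K) / 1%:R), 0%N.
have ubS m : ubound S ((b m.+1 + K) / m.+1%:R) by move=> _ [n ->].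
exists (sup S) => -[|i]; first by have := hb 0%N 0%N; rewrite mul0r !subr0 addn0 subrr sub0r normrN.
have h1 : sup S <= (b i.+1 + K) / i.+1%:R by apply: ge_sup.
have h2 : (b i.+1 - K) / i.+1%:R <= sup S.
  by apply: ub_le_sup; [exists ((b 1%N + K) / 1%:R)|exists i].
move: h1 h2; rewrite ler_pdivlMr ?ltr0n// ler_pdivrMr ?ltr0n// mulrC => h1 h2.
by rewrite ler_norml; apply/andP; split; lra.
Qed.

Definition repeat_path j (t : seq (cvec R)) := flatten (nseq j t).

Lemma size_repeat j t : size (repeat_path j t) = (j * size t)%N.
Proof. by elim: j => [//|j IH] /=; rewrite size_cat -/(repeat_path j t) IH mulSn. Qed.

Lemma repeat_path_cycle a t j : path (child w) a t -> last a t = a ->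
  path (child w) a (repeat_path j t) /\ last a (repeat_path j t) = a.
Proof.
move=> pt lt; elim: j => [//|j [IH1 IH2]] /=.
by rewrite cat_path last_cat -/(repeat_path j t) pt lt IH1 IH2.
Qed.

Lemma repeat_pathD i j t : repeat_path (i + j) t = repeat_path i t ++ repeat_path j t.
Proof. by rewrite /repeat_path nseqD flatten_cat. Qed.

Definition log_mass n D := ln (cover_mass w n D).

Lemma log_mass_desc_le n D s : D \in net w n ->
  path (child w) (charvec w n D) s ->
  log_mass (n + size s) (desc w n D s) <= log_mass n D.
Proof.
move=> Dn ps; have [Dn' _ _] := descP Hmu Dn ps.
by rewrite ler_ln ?posrE ?(cover_mass_gt0 Hmu)// (cover_mass_desc_le Hmu).
Qed.

Lemma log_mass_desc_ge n D s : D \in net w n ->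
  path (child w) (charvec w n D) s ->
  log_mass n D + (size s)%:R * ln p0 <= log_mass (n + size s) (desc w n D s).
Proof.
move=> Dn ps; have [Dn' _ _] := descP Hmu Dn ps.
have Q0 := cover_mass_gt0 Hmu Dn.
have pX : 0 < p0 ^+ size s by rewrite exprn_gt0// p_gt0.
rewrite mulr_natl -lnXn ?p_gt0// addrC -lnM ?posrE//.
rewrite ler_ln ?posrE ?(cover_mass_gt0 Hmu) ?mulr_gt0//.
exact: cover_mass_desc_ge Hmu _ _ _ Dn ps.
Qed.

(** By distortion the increment of log Q over j turns depends on the starting interval only up to
    |ln k|. Restarting after i turns therefore makes it quasi-additive in j. *)
Lemma log_mass_growth a t : admissible_cycle w a t -> positive_mx (Tmat w a t) ->
  exists lam C, forall n D j, D \in net w n -> charvec w n D = a ->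
    `|log_mass (n + j * size t) (desc w n D (repeat_path j t)) - log_mass n D
      - j%:R * lam| <= C.
Proof.
move=> [_ [[n0 [D0 [Dn0 aE]]] pt] lt] pos.
have [k k0 hk] := cover_mass_distortion Hmu pt pos.
rewrite lt in hk.
pose inc n D j := log_mass (n + j * size t) (desc w n D (repeat_path j t)) - log_mass n D.
have cmp n D n' D' j : D \in net w n -> charvec w n D = a ->
    D' \in net w n' -> charvec w n' D' = a -> inc n D j - inc n' D' j <= `|ln k|.
  (* The distortion estimate uses a first copy of the positive cycle, so j = 0 is treated apart. *)
  move=> Dn Da Dn' Da'; case: j => [|j].
    by rewrite /inc /repeat_path/= !mul0n !addn0 !subrr normr_ge0.
  have [pr lr] := repeat_path_cycle j pt lt.
  have pr1 : path (child w) a (repeat_path j.+1 t).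
    by have [] := repeat_path_cycle j.+1 pt lt.
  have := hk _ pr _ _ _ _ Dn Da Dn' Da'.
  rewrite -[t ++ _]/(repeat_path j.+1 t) size_repeat.
  have [Fn _ _] : [/\ desc w n D (repeat_path j.+1 t) \in net w (n + j.+1 * size t), True & True].
    by split => //; rewrite -size_repeat; case: (descP Hmu Dn (s := repeat_path j.+1 t)); rewrite ?Da.
  have [Fn' _ _] : [/\ desc w n' D' (repeat_path j.+1 t) \in net w (n' + j.+1 * size t), True & True].
    by split => //; rewrite -size_repeat; case: (descP Hmu Dn' (s := repeat_path j.+1 t)); rewrite ?Da'.
  have q1 := cover_mass_gt0 Hmu Fn; have q2 := cover_mass_gt0 Hmu Fn'.
  have q3 := cover_mass_gt0 Hmu Dn; have q4 := cover_mass_gt0 Hmu Dn'.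
  rewrite -ler_ln ?posrE ?mulr_gt0// !lnM ?posrE ?mulr_gt0//.
  by have := ler_norm (- ln k); rewrite normrN /inc /log_mass; lra.
have [i j|lam hlam] := @quasi_additive (inc n0 D0) `|ln k|.
  have [pi li] := repeat_path_cycle i pt lt.
  rewrite aE in pi.
  have [Fn _ Fa] := descP Hmu Dn0 pi.
  rewrite -aE li size_repeat in Fa; rewrite size_repeat in Fn.
  have c1 := cmp _ _ _ _ j Fn Fa Dn0 (esym aE).
  have c2 := cmp _ _ _ _ j Dn0 (esym aE) Fn Fa.
  move: c1 c2.
  have -> : inc (n0 + i * size t)%N (desc w n0 D0 (repeat_path i t)) j = inc n0 D0 (i + j)%N - inc n0 D0 i.
    rewrite /inc repeat_pathD desc_cat size_repeat mulnDl addnA.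
    by rewrite opprB addrA subrK.
  by move=> ? ?; rewrite ler_norml; apply/andP; split; lra.
(* One |ln k| comes from quasi-additivity at D0, the other from replacing D0 by D. *)
exists lam, (2 * `|ln k|) => n D j Dn Da.
have c1 := cmp _ _ _ _ j Dn Da Dn0 (esym aE).
have c2 := cmp _ _ _ _ j Dn0 (esym aE) Dn Da.
have := hlam j; rewrite -/(inc n D j) !ler_norml => /andP[? ?].
by apply/andP; split; lra.
Qed.

(** Links the nested intervals of a symbolic representation with [desc]; uniqueness of children
    identifies them level by level. *)
Lemma chain_desc (Delta : nat -> interv R) n s :
  (forall k, is_child w k (Delta k) (Delta k.+1)) ->
  (forall i, (i < size s)%N -> charvec w (n + i).+1 (Delta (n + i).+1) = nth (0, [::], 0%N) s i) ->
  Delta (n + size s)%N = desc w n (Delta n) s.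
Proof.
move=> ch; elim: s n => [|b s IH] n hs; first by rewrite addn0.
have hb : charvec w n.+1 (Delta n.+1) = b by have := hs 0%N isT; rewrite addn0.
have Dn : Delta n \in net w n by case/and3P: (ch n).
have cb : child w (charvec w n (Delta n)) b.
  by apply/asboolP; exists (n, Delta n, Delta n.+1).
have [F [chF Fb ->]] := desc_cons Hmu s Dn cb.
have -> : F = Delta n.+1 by apply: (child_unique chF (ch n)); rewrite Fb hb.
by rewrite -addSnnS; apply: IH => i si; rewrite addSnnS hs.
Qed.

(** At each step the child below D' is the rescaled child below D, and the rescaling between the two
    children is again the same affine map. *)
Lemma desc_offset n D n' D' s : D \in net w n -> D' \in net w n' ->
  charvec w n D = charvec w n' D' -> path (child w) (charvec w n D) s ->
  desc w n' D' s = rescale_itv w n D n' D' (desc w n D s).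
Proof.
elim: s n D n' D' => [|b s IH] n D n' D' Dn Dn' e.
  move=> _ /=; have T := charvec_same_shape Dn Dn' e.
  by rewrite /rescale_itv rescale1 (rescale2 T) -surjective_pairing.
rewrite [path _ _ _]/= => /andP[cb pb].
have [F [ch Fb ->]] := desc_cons Hmu s Dn cb.
rewrite e in cb; have [F' [ch' Fb' ->]] := desc_cons Hmu s Dn' cb.
have /and3P[_ Fn _] := ch; have /and3P[_ Fn' _] := ch'.
rewrite -Fb in pb; rewrite (IH _ _ _ _ Fn Fn' _ pb) ?Fb ?Fb'//.
have := child_offset Hmu ch ch' e; rewrite Fb Fb' => /(_ erefl) FE.
have r x : rescale w n.+1 F n'.+1 F' x = rescale w n D n' D' x.
  rewrite /rescale FE /rescale_itv/= /rescale !exprS.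
  have ? := rhoX_neq0 w n; have ? := rhoX_neq0 w n'.
  have ? : rho w != 0 by rewrite gt_eqF// rho_gt0.
  by field; do !(apply/andP; split).
by rewrite /rescale_itv !r.
Qed.

(** The two children chosen at a step both contain the common final interval, so they coincide and
    have the same letter. *)
Lemma desc_inj n D s1 s2 : D \in net w n -> size s1 = size s2 ->
  path (child w) (charvec w n D) s1 -> path (child w) (charvec w n D) s2 ->
  desc w n D s1 = desc w n D s2 -> s1 = s2.
Proof.
elim: s1 n D s2 => [|b s1 IH] n D [|c s2]// Dn [sz].
rewrite ![path _ _ _]/= => /andP[cb pb] /andP[cc pc].
have [F [ch Fb ->]] := desc_cons Hmu s1 Dn cb.
have [G [ch' Gc ->]] := desc_cons Hmu s2 Dn cc.
move=> e.
have /and3P[_ Fn _] := ch; have /and3P[_ Gn _] := ch'.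
rewrite -Fb in pb; rewrite -Gc in pc.
have [h1 h2 _] := descP Hmu Fn pb; have [_ h3 _] := descP Hmu Gn pc.
have FG : F = G.
  by apply: (sub_net_eq Fn Gn (net_lt h1) h2); rewrite e.
subst G; have -> : b = c by rewrite -Fb -Gc.
by congr cons; apply: (IH n.+1 F).
Qed.

End Growth.

(** * Local dimension from a quadratically spaced sequence of radii *)

Section Criterion.
Variables (R : realType) (w : wifs R) (mu : probability (measurableTypeR R) R).
Hypothesis Hmu : standard_assumptions w mu.

Lemma ln_rho_lt0 : ln (rho w) < 0.
Proof. by rewrite ln_lt0// rho_gt0 rho_lt1. Qed.

(** With N(k) close to L k^2, consecutive exponents differ by O(k), and so do the logarithms of the
    masses. Monotonicity of the mass in the radius thus controls all intermediate r with a relative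
    error O(1/k). *)
Lemma locdim_criterion (x lam L C : R) (N : nat -> nat) : 0 < L ->
  (forall k, `|(N k)%:R - L * k%:R ^+ 2| <= C * k.+1%:R) ->
  (forall k, 0 < mass mu `[x - rho w ^+ N k, x + rho w ^+ N k]%classic) ->
  (forall k, `|ln (mass mu `[x - rho w ^+ N k, x + rho w ^+ N k]%classic)
     - lam * k%:R ^+ 2| <= C * k.+1%:R) ->
  locdim_quotient mu x r @[r --> 0^'+] --> lam / (L * ln (rho w)).
Proof.
move=> L0 hN m0 hm.
have [l l0 lE] : exists2 l, 0 < l & ln (rho w) = - l.
  by exists (- ln (rho w)); rewrite ?oppr_gt0 ?ln_rho_lt0// opprK.
have C0 : 0 <= C by have := le_trans (normr_ge0 _) (hN 0%N); rewrite mulr1.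
apply/cvgrPdist_le => e e0.
pose A := 4 * `|lam| * L + 2 * C * `|lam| + 2 * C * L.
(* From K = K1 + 1 on, e L l (L k - 2C) exceeds 2A by at least e L l, which brings the final
   quotient below e. *)
have [K1 hK1] : exists K : nat, (2 * A / (e * L * l) + 2 * C + 1) / L <= K%:R.
  by exists (Num.truncn ((2 * A / (e * L * l) + 2 * C + 1) / L)).+1; apply/ltW/truncnS_gt.
pose K := K1.+1.
near=> r.
have r0 : 0 < r by near: r; exact: nbhs_right_gt.
have rK : r < rho w ^+ N K by near: r; apply: nbhs_right_lt; exact: rhoX_gt0.
have lnX n : ln (rho w ^+ n) = - (n%:R * l) by rewrite lnXn ?rho_gt0// lE mulNrn mulr_natl.
(* v is the real exponent with r = rho^v. *)
pose v := - ln r / l.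
have lnr : ln r = - (v * l) by rewrite /v divfK ?gt_eqF// opprK.
have Nv k : ((N k)%:R <= v) = (r <= rho w ^+ N k).
  by rewrite -ler_ln ?posrE ?rhoX_gt0// lnX lnr lerN2 ler_pM2r.
have A0 : 0 <= A by rewrite !addr_ge0 ?mulr_ge0// ltW.
have big k : (K <= k)%N -> 2 * A + e * L * l <= e * L * l * (L * k%:R - 2 * C) /\ 1 <= k%:R :> R.
  move=> Kk; have : K1%:R + 1 <= k%:R :> R by rewrite natr1 ler_nat.
  have K10 : 0 <= K1%:R :> R by rewrite ler0n.
  move=> Kk'; split; last lra.
  have c0 : 0 < e * L * l by rewrite !mulr_gt0.
  have : 2 * A / (e * L * l) + 2 * C + 1 <= L * k%:R.
    by move: hK1; rewrite ler_pdivrMr// [K1%:R * L]mulrC => h; apply: (le_trans h); rewrite ler_pM2l//; lra.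
  have -> : 2 * A + e * L * l = e * L * l * (2 * A / (e * L * l) + 1).
    by field; rewrite !gt_eqF.
  by move=> h; rewrite ler_pM2l//; lra.
have low k : (K <= k)%N -> (L * k%:R - 2 * C) * k%:R <= (N k)%:R.
  move=> Kk; have [_ k1] := big k Kk; have := hN k; rewrite ler_norml -natr1 => /andP[h _].
  have : C * (k%:R + 1) <= C * (2 * k%:R) by apply: ler_wpM2l => //; lra.
  by move: h; rewrite expr2; nra.
have c0 : 0 < e * L * l by rewrite !mulr_gt0.
have exP : exists k, (fun k => (K <= k)%N && ((N k)%:R <= v)) k.
  by exists K; rewrite leqnn Nv ltW.
have ub k : (K <= k)%N && ((N k)%:R <= v) -> (k <= (Num.truncn v).+1)%N.
  move=> /andP[Kk kv]; have [b1 b2] := big k Kk.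
  have g1 : 1 <= L * k%:R - 2 * C.
    by rewrite -(ler_pM2l c0) mulr1; apply: le_trans b1; lra.
  have g2 : k%:R <= v.
    by apply: le_trans kv; apply: le_trans (low k Kk); rewrite ler_peMl//; lra.
  rewrite -(ler_nat R); apply: (le_trans g2); exact/ltW/truncnS_gt.
(* Taking the largest k >= K with N(k) <= v gives rho^N(k+1) < r <= rho^N(k) without monotonicity of
   N. *)
case: (ex_maxnP exP ub) => k /andP[Kk kv] kmax.
have {kmax} kv1 : v < (N k.+1)%:R.
  rewrite ltNge; apply/negP => h; have := kmax k.+1.
  by rewrite h (leq_trans Kk)// ltnn => /(_ isT).
have [b1 b2] := big k Kk.
set M := mass mu `[x - r, x + r]%classic.
have M1 : mass mu `[x - rho w ^+ N k.+1, x + rho w ^+ N k.+1]%classic <= M.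
  have : rho w ^+ N k.+1 < r by rewrite ltNge -Nv -ltNge.
  by move=> ?; apply: le_mass; lra.
have M2 : M <= mass mu `[x - rho w ^+ N k, x + rho w ^+ N k]%classic.
  have : r <= rho w ^+ N k by rewrite -Nv.
  by move=> ?; apply: le_mass; lra.
have M0 : 0 < M by exact: lt_le_trans M1.
have lM1 := M1; rewrite -ler_ln ?posrE// in lM1.
have lM2 := M2; rewrite -ler_ln ?posrE// in lM2.
have := hm k.+1; have := hm k; have := hN k.+1; have := hN k.
rewrite !ler_norml -!(natr1 k.+1) -!(natr1 k).
move=> /andP[n1 n2] /andP[n3 n4] /andP[q1 q2] /andP[q3 q4].
set kk : R := k%:R in b1 b2 n1 n2 n3 n4 q1 q2 q3 q4.
have v0 : 0 < v.
  apply: lt_le_trans kv; apply: lt_le_trans (low _ Kk).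
  have : 0 < L * k%:R - 2 * C.
    by rewrite -(pmulr_rgt0 _ c0); apply: lt_le_trans b1; lra.
  by move=> ?; rewrite mulr_gt0//; lra.
have E1 : `|v - L * kk ^+ 2| <= (2 * L + 2 * C) * (kk + 1).
  clear - L0 C0 n1 n2 n3 n4 kv kv1 b2.
  by rewrite ler_norml; apply/andP; split; nra.
have E2 : `|ln M - lam * kk ^+ 2| <= (2 * `|lam| + 2 * C) * (kk + 1).
  have la := ler_norm lam; have lb := ler_norm (- lam); rewrite normrN in lb.
  clear - la lb C0 q1 q2 q3 q4 lM1 lM2 b2.
  by rewrite ler_norml; apply/andP; split; nra.
have num : `|lam * v - L * ln M| <= A * (kk + 1).
  have -> : lam * v - L * ln M = lam * (v - L * kk ^+ 2) - L * (ln M - lam * kk ^+ 2) by ring.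
  apply: le_trans (ler_normB _ _) _; rewrite !normrM (gtr0_norm L0).
  have -> : A * (kk + 1) = `|lam| * ((2 * L + 2 * C) * (kk + 1)) + L * ((2 * `|lam| + 2 * C) * (kk + 1)).
    by rewrite /A; ring.
  by apply: lerD; [apply: ler_wpM2l|rewrite ler_pM2l].
have lowv := le_trans (low _ Kk) kv; rewrite -/kk in lowv.
rewrite /locdim_quotient -/(mass mu _) -/M lnr.
have -> : lam / (L * ln (rho w)) - ln M / - (v * l) = - ((lam * v - L * ln M) / (L * l * v)).
  rewrite lE; field.
  by rewrite !gt_eqF.
have lv0 : 0 < L * l * v by apply: mulr_gt0 => //; exact: mulr_gt0.
rewrite -ler_norml normrN normrM [`|_^-1|]gtr0_norm ?invr_gt0//.
rewrite ler_pdivrMr//; apply: (le_trans num).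
have h1 : A * (kk + 1) <= 2 * A * kk by clear - A0 b2; nra.
apply: (le_trans h1); apply: le_trans (_ : e * L * l * ((L * kk - 2 * C) * kk) <= _).
  rewrite mulrA; apply: ler_wpM2r; first exact: ler0n.
  by apply: le_trans b1; rewrite lerDl ltW.
by rewrite [leRHS](_ : _ = e * L * l * v) ?ler_pM2l//; ring.
Unshelve. all: end_near.
Qed.

End Criterion.

(** * Local dimension at periodic points *)

Section Periodic.
Variables (R : realType) (w : wifs R) (mu : probability (measurableTypeR R) R).
Hypothesis Hmu : standard_assumptions w mu.
Local Notation p0 := (@p R w ord0).

Section Chain.
Variables (Delta : nat -> interv R) (x : R).
Hypothesis Hch : forall n, is_child w n (Delta n) (Delta n.+1).
Hypothesis Hx : forall n, (Delta n).1 <= x <= (Delta n).2.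

Lemma chain_net n : Delta n \in net w n.
Proof. by case/and3P: (Hch n). Qed.

Lemma mass_ge_chain : exists2 c, 0 < c & forall n,
  c * cover_mass w n (Delta n)
  <= mass mu `[x - rho w ^+ n, x + rho w ^+ n]%classic.
Proof.
have [c c0 hc] := mass_ge_cover Hmu; exists c => // n.
apply: (le_trans (hc _ _ (chain_net n))).
have := net_len Hmu (chain_net n); have /andP[? ?] := Hx n.
by move=> ?; apply: le_mass; lra.
Qed.

Lemma cover_mass_chain n i :
  p0 ^+ i * cover_mass w n (Delta n) <= cover_mass w (n + i) (Delta (n + i)).
Proof.
elim: i => [|i IH]; first by rewrite addn0 mul1r.
rewrite addnS exprS -mulrA; apply: le_trans (cover_mass_child_ge Hmu (Hch _)).
by rewrite ler_pM2l ?p_gt0.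
Qed.

(** Besides the words counted by Q([Delta n]), this includes those whose interval meets [Delta n]
    only at an endpoint equal to x. *)
Definition word_mass n : R :=
  wsum n (fun s : seq (alphabet w) => (Sw s 0 <= x <= Sw s 1)%R%:R).

Lemma word_mass_ge0 n : 0 <= word_mass n.
Proof. exact: wsum_ge0. Qed.

(* A word interval with x as an endpoint has a single child containing x, of
   relative weight p_0 = p_m; one with x in its interior covers Delta n. *)
Lemma word_mass_rec n : isend w n x ->
  word_mass n.+1 <= p0 * word_mass n + cover_mass w n (Delta n).
Proof.
move=> ex; rewrite /word_mass /cover_mass -wsumZ -wsumD /=.
apply: ler_wsum => s sn.
have rn := rhoX_gt0 w n; have p00 := p_ge0 (@ord0 (msize w) : alphabet w).
have sub (l : alphabet w) : Sw (rcons s l) 0 <= x <= Sw (rcons s l) 1 ->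
    [/\ Sw s 0 <= x <= Sw s 1, x = Sw s 0 -> l = ord0 & x = Sw s 1 -> l = ord_max].
  rewrite !Sw_rcons !S1E mulr0 mulr1 add0r => /andP[].
  have /andP[a1 _] : Sw s 0 <= Sw s (d l) <= Sw s 1.
    by apply: Sw_in; have [? ?] := stable_supp Hmu l; have := rho_gt0 w; move=> ?; apply/andP; split; lra.
  have /andP[_ a2] : Sw s 0 <= Sw s (rho w + d l) <= Sw s 1.
    by apply: Sw_in; have [? ?] := stable_supp Hmu l; have := rho_gt0 w; move=> ?; apply/andP; split; lra.
  move=> b1 b2; split; first by apply/andP; split; lra.
    move=> xs; apply: d_inj; rewrite (d_first Hmu); apply/le_anti.
    have [-> _] := stable_supp Hmu l; rewrite andbT.
    by move: b1; rewrite SwE sn xs gerDl pmulr_rle0.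
  move=> xs; apply: d_inj; rewrite (d_last Hmu); apply/le_anti.
  have [_ ?] := stable_supp Hmu l; apply/andP; split; first lra.
  move: b2; rewrite xs Sw1_sub (SwE s (rho w + d l)) sn lerD2l -[leLHS]mulr1 ler_pM2l//; lra.
have one (l0 : alphabet w) : p l0 = p0 ->
    (forall l, Sw (rcons s l) 0 <= x <= Sw (rcons s l) 1 -> l = l0) ->
    \sum_l p l * (Sw (rcons s l) 0 <= x <= Sw (rcons s l) 1)%R%:R <= p0.
  move=> pl hl; rewrite (bigD1 l0)//= big1 ?addr0 => [|l ll].
    by rewrite pl; case: (_ <= _ <= _); rewrite ?mulr1 ?mulr0.
  case: (boolP (_ <= _ <= _)) => [/hl e|_]; last by rewrite mulr0.
  by rewrite e eqxx in ll.
case: (boolP (Sw s 0 <= x <= Sw s 1)) => xs; last first.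
  rewrite big1 ?addr_ge0 ?mulr_ge0// => l _.
  case: (boolP (_ <= _ <= _)) => [/sub[xs']|_]; last by rewrite mulr0.
  by rewrite xs' in xs.
have [e|n0] := eqVneq x (Sw s 0).
  apply: le_trans (one ord0 erefl _) _ => [l /sub[_ h _]|]; first exact: h.
  by rewrite mulr1 lerDl.
have [e|n1] := eqVneq x (Sw s 1).
  apply: le_trans (one ord_max _ _) _ => [|l /sub[_ _ h]|]; last by rewrite mulr1 lerDl.
    by case: (Hmu) => _ _ [<-].
  exact: h.
have c : cov s (Delta n).
  move: xs; rewrite !le_eqVlt eq_sym (negbTE n0) (negbTE n1)/= => /andP[x0 x1].
  have /netP[_ _ _ h] := chain_net n; have /andP[D1 D2] := Hx n.
  have hs0 : isend w n (Sw s 0) by exists s => //; left.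
  have hs1 : isend w n (Sw s 1) by exists s => //; right.
  apply/andP => /=; case: (h _ ex) => ?.
    by split; [lra|case: (h _ hs1) => //; lra].
  by split; [case: (h _ hs0) => //; lra|lra].
rewrite c; apply: le_trans (_ : 1 <= _); last by rewrite lerDr mulr_ge0.
apply: (@le_trans _ _ (\sum_(l : alphabet w) p l)); last by rewrite p_sum1.
apply: ler_sum => l _.
by case: (_ <= _ <= _); rewrite ?mulr1 ?mulr0 ?p_ge0.
Qed.

(** Q drops by at most the factor p_0 per level, so by [word_mass_rec] the quotient of [word_mass]
    by Q grows by at most 1/p_0 per level. *)
Lemma word_mass_bound n : isend w n x -> exists2 B, 0 <= B & forall i,
  word_mass (n + i) <= (B + i%:R / p0) * cover_mass w (n + i) (Delta (n + i)).
Proof.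
move=> ex; have Q0 k := cover_mass_gt0 Hmu (chain_net k).
have pp : 0 < p0 by exact: p_gt0.
have [B B0 BE] : exists2 B, 0 <= B & B = word_mass n / cover_mass w n (Delta n).
  by eexists; last reflexivity; rewrite divr_ge0 ?word_mass_ge0 ?(ltW (Q0 n)).
exists B => //; elim=> [|i IH].
  by rewrite addn0 mul0r addr0 BE divfK ?gt_eqF.
have ei : isend w (n + i) x by apply: (isend_le Hmu _ ex); rewrite leq_addr.
rewrite addnS; apply: (le_trans (word_mass_rec ei)).
apply: (@le_trans _ _ ((B + i.+1%:R / p0) * (p0 * cover_mass w (n + i) (Delta (n + i))))).
  rewrite -(natr1 i); move: IH; set Q := cover_mass _ _ _ => IH.
  apply: (@le_trans _ _ (p0 * ((B + i%:R / p0) * Q) + Q)).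
    by rewrite lerD2r ler_pM2l.
  rewrite le_eqVlt; apply/orP; left; apply/eqP; field.
  by rewrite gt_eqF.
apply: ler_wpM2l; last exact: (cover_mass_child_ge Hmu (Hch _)).
by rewrite addr_ge0// divr_ge0// ltW.
Qed.

(** When x is an endpoint of level n, a word interval not containing x stays at distance at least c
    rho^n from it; J is chosen with rho^J < c. *)
Lemma mass_le_word_mass : exists J, forall n, isend w n x ->
  mass mu `[x - rho w ^+ (n + J), x + rho w ^+ (n + J)]%classic <= word_mass n.
Proof.
have [c c0 hc] := isend_sep Hmu; have [J hJ] := rhoX_small w c0.
exists J => n ex; apply: (mass_le_wsum Hmu) => s sn s0 s1.
have rn := rhoX_gt0 w n.
have lt : rho w ^+ (n + J) < c * rho w ^+ n by rewrite exprD mulrC ltr_pM2r.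
have hs0 : isend w n (Sw s 0) by exists s => //; left.
have hs1 : isend w n (Sw s 1) by exists s => //; right.
apply/andP; split; rewrite leNgt; apply/negP => h.
  by have := hc _ _ _ ex hs0 h; lra.
by have := hc _ _ _ hs1 ex h; lra.
Qed.

End Chain.

Definition growth_rate (a : cvec R) (t : seq (cvec R)) (lam : R) :=
  exists C, forall n D j, D \in net w n -> charvec w n D = a ->
    `|log_mass w (n + j * size t) (desc w n D (repeat_path j t)) - log_mass w n D
      - j%:R * lam| <= C.

Lemma periodic_chain x a t : has_period w x a t ->
  exists (Delta : nat -> interv R) n, [/\ forall k, (Delta k).1 <= x <= (Delta k).2,
    forall k, is_child w k (Delta k) (Delta k.+1),
    forall j, charvec w (n + j * size t) (Delta (n + j * size t)%N) = a &
    forall j i, Delta (n + j * size t + i * size t)%N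
      = desc w (n + j * size t) (Delta (n + j * size t)%N) (repeat_path i t)].
Proof.
move=> [[tn _ lt] [g [s [[Delta [Dx Dch gD]] gt]]]].
have L0 : (0 < size t)%N by case: (t) tn.
have D0 j : charvec w (s.+1 + j * size t) (Delta (s.+1 + j * size t)%N) = a.
  rewrite -gD gt modnMl; by case: (t) L0.
have D1 j : Delta (s.+1 + j * size t + size t)%N
    = desc w (s.+1 + j * size t) (Delta (s.+1 + j * size t)%N) t.
  apply: (chain_desc Hmu Dch) => i it.
  rewrite -gD (_ : (_ + i).+1 = s.+1 + (j * size t + i.+1))%N; last by lia.
  rewrite gt modnMDl.
  (* The last letter of t is separate: there the index wraps around to 0, where [belast a t] starts
     with a = [last a t]. *)
  move: it; rewrite leq_eqVlt => /orP[/eqP iL|iL].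
    rewrite iL modnn (_ : i = (size t).-1) ?nth_last -?iL//.
    by case: (t) L0 lt => //= b r _ ->.
  rewrite modn_small// [RHS](set_nth_default a); last exact: ltnW.
  by rewrite -[RHS]/(nth a (a :: t) i.+1) lastI nth_rcons size_belast iL.
exists Delta, s.+1; split => // j i; elim: i j => [|i IH] j; first by rewrite addn0.
rewrite /repeat_path/= -/(repeat_path i t) desc_cat -D1.
have -> : (s.+1 + j * size t + size t = s.+1 + j.+1 * size t)%N by rewrite mulSn; lia.
by rewrite -IH; congr (Delta _); rewrite !mulSn; lia.
Qed.

(** If x is an endpoint of some level, [word_mass] bounds the mass at the cost of a factor linear in
    j. Otherwise a few turns of the cycle separate x from both ends of [Delta n], and by
    [desc_offset] the same relative separation recurs after every turn. *)
Lemma periodic_upper x a t : has_period w x a t ->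
  exists (Delta : nat -> interv R) n J C,
  0 < C /\ [/\ forall k, (Delta k).1 <= x <= (Delta k).2,
    forall k, is_child w k (Delta k) (Delta k.+1),
    charvec w n (Delta n) = a,
    forall i, Delta (n + i * size t)%N = desc w n (Delta n) (repeat_path i t) &
    forall j, mass mu `[x - rho w ^+ (n + j * size t + J), x + rho w ^+ (n + j * size t + J)]%classic
      <= C * j.+1%:R * cover_mass w (n + j * size t) (Delta (n + j * size t)%N)].
Proof.
move=> hp; have [Delta [n [Dx Dch Da Dd]]] := periodic_chain hp.
have L0 : (0 < size t)%N by case: hp => -[]; case: (t).
have Q0 k := cover_mass_gt0 Hmu (chain_net Dch k).
have pp : 0 < p0 by exact: p_gt0.
have [[m ex]|nex] := pselect (exists m, isend w m x).
  pose k0 := (n + m * size t)%N.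
  have mk : (m <= k0)%N by rewrite /k0; have := leq_pmulr m L0; lia.
  have ek : isend w k0 x by exact: (isend_le Hmu mk ex).
  have [B B0 hB] := word_mass_bound Dch Dx ek.
  have [J hJ] := mass_le_word_mass x.
  exists Delta, k0, J, (B + (size t)%:R / p0); split; last split => //.
  - by rewrite ltr_wpDl// divr_gt0// ltr0n.
  - exact: Da.
  - by move=> i; exact: Dd.
  move=> j; apply: (le_trans (hJ _ _)).
    by apply: (isend_le Hmu _ ek); rewrite leq_addr.
  apply: (le_trans (hB _)); apply: ler_wpM2r; first exact/ltW/Q0.
  rewrite natrM mulrDl; apply: lerD.
    by rewrite ler_peMr// ler1n.
  rewrite [leRHS]mulrAC; apply: ler_wpM2r; first by rewrite invr_ge0 ltW.
  by rewrite mulrC; apply: ler_wpM2l; rewrite ?ler0n// ler_nat.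
have strict k : (Delta k).1 < x < (Delta k).2.
  have /netP[e1 e2 _ _] := chain_net Dch k; have /andP[x1 x2] := Dx k.
  rewrite !lt_neqAle x1 x2 !andbT; apply/andP; split.
    by apply/eqP => e; apply: nex; exists k; rewrite -e.
  by apply/eqP => e; apply: nex; exists k; rewrite e.
(* After j1 turns the net interval is shorter than the distance from x to either end of
   [Delta n]. *)
have [j1 [g1 g2]] : exists j1, (Delta n).1 < (Delta (n + j1 * size t)%N).1 /\
    (Delta (n + j1 * size t)%N).2 < (Delta n).2.
  have /andP[x1 x2] := strict n.
  have [|j1 hj] := @rhoX_small R w (Num.min (x - (Delta n).1) ((Delta n).2 - x)).
    by rewrite lt_min !subr_gt0 x1 x2.
  exists j1; move: hj; rewrite lt_min => /andP[h1 h2].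
  have := net_len Hmu (chain_net Dch (n + j1 * size t)%N).
  have : rho w ^+ (n + j1 * size t) <= rho w ^+ j1.
    rewrite ler_wiXn2l ?(ltW (rho_gt0 w)) ?(ltW (rho_lt1 w))//.
    by have := leq_pmulr j1 L0; lia.
  by have /andP[? ?] := Dx (n + j1 * size t)%N; split; lra.
have [c c0 hc] := isend_sep Hmu; have [J0 hJ] := rhoX_small w c0.
have Dn := chain_net Dch n.
have pr i j : path (child w) (charvec w (n + j * size t) (Delta (n + j * size t)%N)) (repeat_path i t).
  rewrite Da; case: (hp) => -[_ [_ pt] lt] _.
  by have [] := repeat_path_cycle i pt lt.
exists Delta, n, (j1 * size t + J0)%N, 1; split => //; split => //.
- by have := Da 0%N; rewrite mul0n addn0.
- by move=> i; have := Dd 0%N i; rewrite mul0n addn0.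
move=> j; rewrite mul1r.
apply: (@le_trans _ _ (cover_mass w (n + j * size t) (Delta (n + j * size t)%N))); last first.
  by rewrite ler_peMl ?ler1n// ltW.
have n0 : (n = n + 0 * size t)%N by rewrite mul0n addn0.
have e : charvec w n (Delta n) = charvec w (n + j * size t) (Delta (n + j * size t)%N).
  by rewrite Da {1 2}n0 Da.
have DE := desc_offset Hmu Dn (chain_net Dch (n + j * size t)%N) e.
have pr0 : path (child w) (charvec w n (Delta n)) (repeat_path j1 t) by rewrite e; exact: pr.
have {}DE := DE _ pr0; rewrite -Dd in DE.
have Dd0 : desc w n (Delta n) (repeat_path j1 t) = Delta (n + j1 * size t)%N.
  by have := Dd 0%N j1; rewrite mul0n addn0.
rewrite Dd0 in DE.
have T := charvec_same_shape Dn (chain_net Dch (n + j * size t)%N) e.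
set k := (n + j * size t)%N in DE T *; set k' := (k + j1 * size t)%N in DE.
have h1 : (Delta k).1 < (Delta k').1.
  by rewrite DE /= -(rescale1 w n (Delta n) k (Delta k)) ltr_rescale.
have h2 : (Delta k').2 < (Delta k).2.
  by rewrite DE /= -(rescale2 T) ltr_rescale.
have /netP[e1 e2 _ _] := chain_net Dch k; have /netP[e3 e4 _ _] := chain_net Dch k'.
have kk : (k <= k')%N by rewrite leq_addr.
have := hc _ _ _ (isend_le Hmu kk e1) e3 h1.
have := hc _ _ _ e4 (isend_le Hmu kk e2) h2.
have lt : rho w ^+ (k' + J0) < c * rho w ^+ k'.
  by rewrite exprD mulrC ltr_pM2r// rhoX_gt0.
have := rhoX_gt0 w (k' + J0)%N; rewrite addnA -/k'.
have /andP[? ?] := Dx k' => ? ? ?.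
by apply: (mass_le_cover Hmu (chain_net Dch k)); lra.
Qed.

Lemma periodic_locdim x a t lam : has_period w x a t -> growth_rate a t lam ->
  locdim_quotient mu x r @[r --> 0^'+] --> lam / ((size t)%:R * ln (rho w)).
Proof.
move=> hp [C1 hg].
have L0 : (0 < size t)%N by case: hp => -[]; case: (t).
have [Delta [n [J [C [C0 [Dx Dch Da Dd up]]]]]] := periodic_upper hp.
have [c c0 low] := mass_ge_chain Dch Dx.
have Q0 k := cover_mass_gt0 Hmu (chain_net Dch k).
have pp : 0 < p0 by exact: p_gt0.
set L := size t in L0 Dd up hg *.
(* Taking k^2 turns of the cycle matches the quadratic scale of [locdim_criterion]. *)
pose N k := (n + k ^ 2 * L + J)%N.
have m0 k : 0 < mass mu `[x - rho w ^+ k, x + rho w ^+ k]%classic.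
  by apply: lt_le_trans (low k); rewrite mulr_gt0.
(* The summand 2 is there to ensure C2 + 2k <= C2 (k + 1). *)
pose C2 := (n + J)%:R + `|ln c| + `|J%:R * ln p0| + C1 + `|log_mass w n (Delta n)| + `|ln C| + 2.
have gr k : `|log_mass w (n + k ^ 2 * L) (Delta (n + k ^ 2 * L)%N) - log_mass w n (Delta n)
    - (k ^ 2)%:R * lam| <= C1.
  by rewrite Dd; apply: hg => //; exact: chain_net.
have C10 : 0 <= C1 by apply: le_trans (gr 0%N).
have a1 := normr_ge0 (ln c); have a2 := normr_ge0 (J%:R * ln p0).
have a3 := normr_ge0 (log_mass w n (Delta n)); have a4 := normr_ge0 (ln C).
have a5 : 0 <= (n + J)%:R :> R by rewrite ler0n.
have kC k : C2 + 2 * k%:R <= C2 * k.+1%:R.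
  rewrite -(natr1 k) mulrDr mulr1 addrC lerD2r ler_wpM2r ?ler0n// /C2; lra.
apply: (@locdim_criterion R w mu x lam L%:R C2 N) => [|k|k|k] //.
- by rewrite ltr0n.
- apply: le_trans (kC k).
  have -> : (N k)%:R - L%:R * k%:R ^+ 2 = (n + J)%:R :> R.
    by rewrite /N !natrD natrM natrX; ring.
  by rewrite ger0_norm// /C2; have := ler0n R k; lra.
apply: le_trans (kC k).
set M := mass _ _; set k2 := (n + k ^ 2 * L)%N.
have up' : ln M <= ln C + 2 * k%:R + log_mass w k2 (Delta k2).
  have CC : 0 < C * (k ^ 2).+1%:R by rewrite mulr_gt0// ltr0n.
  have : ln M <= ln (C * (k ^ 2).+1%:R * cover_mass w k2 (Delta k2)).
    by rewrite ler_ln ?posrE ?m0 ?mulr_gt0//; exact: up.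
  rewrite lnM ?posrE// lnM ?posrE ?ltr0n//.
  (* The linear factor of [periodic_upper] costs only O(k) in the logarithm. *)
  have : ln ((k ^ 2).+1%:R : R) <= 2 * k%:R.
    apply: (@le_trans _ _ (ln ((1 + k%:R) ^+ 2))).
      have k0 := ler0n R k; have k1 : 0 < 1 + k%:R :> R by lra.
      rewrite ler_ln ?posrE ?ltr0n ?exprn_gt0// -(natr1 (k ^ 2)) natrX.
      by nra.
    rewrite lnXn; last by have := ler0n R k; lra.
    have : ln (1 + k%:R) <= k%:R :> R by apply: le_ln1Dx; have := ler0n R k; lra.
    by rewrite mulr2n; lra.
  by rewrite /log_mass; lra.
have low' : ln c + J%:R * ln p0 + log_mass w k2 (Delta k2) <= ln M.
  have : ln (c * (p0 ^+ J * cover_mass w k2 (Delta k2))) <= ln M.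
    rewrite ler_ln ?posrE ?m0 ?mulr_gt0 ?exprn_gt0//.
    apply: le_trans (low (N k)); rewrite ler_pM2l//.
    exact: cover_mass_chain.
  by rewrite lnM ?posrE ?mulr_gt0 ?exprn_gt0// lnM ?posrE ?exprn_gt0// lnXn// mulr_natl /log_mass; lra.
have := gr k; rewrite natrX -/k2 !ler_norml => /andP[? ?].
have b1 := ler_norm (- ln c); have b2 := ler_norm (- (J%:R * ln p0)).
have b3 := ler_norm (log_mass w n (Delta n)); have b4 := ler_norm (- log_mass w n (Delta n)).
have b5 := ler_norm (ln C).
rewrite !normrN in b1 b2 b4.
have k0 := ler0n R k.
by apply/andP; split; rewrite /C2; lra.
Qed.

End Periodic.

(** * A cycle leading strictly inside every net interval of its type *)

Section Mixing.
Variables (R : realType) (w : wifs R) (mu : probability (measurableTypeR R) R).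
Hypothesis Hmu : standard_assumptions w mu.
Local Notation p0 := (@p R w ord0).

Lemma net_disjoint n D E : D \in net w n -> E \in net w n -> D <> E ->
  D.2 <= E.1 \/ E.2 <= D.1.
Proof.
move=> Dn En DE; case: (lerP D.2 E.1) => h1; first by left.
case: (lerP E.2 D.1) => h2; first by right.
have /netP[d1 d2 d12 hD] := Dn; have /netP[e1 e2 e12 hE] := En.
have c1 : D.1 = E.1.
  by apply/le_anti/andP; split; [case: (hE _ d1)|case: (hD _ e1)]; lra.
case: DE; apply: (@net_eq R w n D E ((D.1 + Num.min D.2 E.2) / 2)) => //;
  by rewrite minElt; case: ifP => ?; lra.
Qed.

Lemma desc_sub_prefix n D s1 s2 : D \in net w n ->
  path (child w) (charvec w n D) (s1 ++ s2) ->
  [/\ desc w n D s1 \in net w (n + size s1), path (child w) (charvec w n D) s1,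
    path (child w) (last (charvec w n D) s1) s2,
    subinterv (desc w n D s1) D & subinterv (desc w n D (s1 ++ s2)) (desc w n D s1)].
Proof.
move=> Dn; rewrite cat_path => /andP[h1 h2]; have [Fn F1 Fa] := descP Hmu Dn h1.
by split => //; rewrite desc_cat; rewrite -Fa in h2; have [] := descP Hmu Fn h2.
Qed.

(* If A and B reach distinct net intervals, their ends lie in a fixed
   left-right order below every net interval of type a; so AB leaves both
   endpoints behind. *)
Lemma interior_of_distinct a s1 r1 s2 r2 : size s1 = size s2 -> s1 <> s2 ->
  path (child w) a (s1 ++ r1) -> last a (s1 ++ r1) = a ->
  path (child w) a (s2 ++ r2) -> last a (s2 ++ r2) = a ->
  forall n D, D \in net w n -> charvec w n D = a ->
  let E := desc w n D ((s1 ++ r1) ++ (s2 ++ r2)) in D.1 < E.1 /\ E.2 < D.2.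
Proof.
move=> sz s12 p1 l1 p2 l2 n D Dn Da E; rewrite -Da in p1 p2.
have [X1n q1 _ X1D X1A] := desc_sub_prefix Dn p1.
have [X2n q2 _ X2D _] := desc_sub_prefix Dn p2.
have [An AD Aa] := descP Hmu Dn p1; rewrite Da l1 in Aa.
have eA : charvec w n D = charvec w (n + size (s1 ++ r1)) (desc w n D (s1 ++ r1)).
  by rewrite Aa.
have p2' := p2; rewrite eA in p2'; have q1' := q1; rewrite eA in q1'.
have [Y2n _ _ Y2D Y2E] := desc_sub_prefix An p2'.
have [Y1n Y1D _] := descP Hmu An q1'.
rewrite -desc_cat -/E in Y2E.
have Y1 := desc_offset Hmu Dn An eA q1; have Y2 := desc_offset Hmu Dn An eA q2.
rewrite -sz in X2n.
have X12 : desc w n D s1 <> desc w n D s2.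
  by move=> e; apply: s12; exact: (desc_inj Hmu Dn sz q1 q2 e).
have n1 := net_lt X1n; have n2 := net_lt X2n.
have m1 := net_lt Y1n; have m2 := net_lt Y2n.
move: X1D X1A X2D AD Y2D Y2E Y1D.
move=> /subintervP[? ?] /subintervP[? ?] /subintervP[? ?] /subintervP[? ?].
move=> /subintervP[? ?] /subintervP[? ?] /subintervP[? ?].
case: (net_disjoint X1n X2n X12) => o.
  have o' : (desc w (n + size (s1 ++ r1)) (desc w n D (s1 ++ r1)) s1).2
     <= (desc w (n + size (s1 ++ r1)) (desc w n D (s1 ++ r1)) s2).1.
    by rewrite Y1 Y2 /= ler_rescale.
  by split; lra.
have o' : (desc w (n + size (s1 ++ r1)) (desc w n D (s1 ++ r1)) s2).2
     <= (desc w (n + size (s1 ++ r1)) (desc w n D (s1 ++ r1)) s1).1.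
  by rewrite Y1 Y2 /= ler_rescale.
by split; lra.
Qed.

(** The path A_j turns only around t, while B_j passes to b by u and turns around t'. If B_j were a
    prefix of A_j for every j, log Q along both would agree up to a constant, forcing lam |t'| =
    lam' |t|. So they part for some j, and [interior_of_distinct] applies. *)
Lemma interior_cycle a t b t' u v lam lam' :
  admissible_cycle w a t -> growth_rate w a t lam ->
  admissible_cycle w b t' -> growth_rate w b t' lam' ->
  path (child w) a u -> last a u = b -> path (child w) b v -> last b v = a ->
  lam * (size t')%:R <> lam' * (size t)%:R ->
  exists iota, [/\ path (child w) a iota, last a iota = a &
    forall n D, D \in net w n -> charvec w n D = a ->
    D.1 < (desc w n D iota).1 /\ (desc w n D iota).2 < D.2].
Proof.
move=> [tn [[n0 [D0 [Dn0 aE]]] pt] lt] [C hC] [tn' [_ pt'] lt'] [C' hC'] pu lu pv lv ne.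
have L0 : (0 < size t)%N by case: (t) tn.
have L0' : (0 < size t')%N by case: (t') tn'.
(* The numbers of turns make |A_j| - |B_j| = |u| (|t| - 1), independent of j. *)
pose A j := repeat_path (size u + j * size t') t.
pose B j := u ++ repeat_path (j * size t) t'.
have sA j : size (A j) = ((size u + j * size t') * size t)%N by exact: size_repeat.
have sB j : size (B j) = (size u + j * size t * size t')%N.
  by rewrite size_cat size_repeat.
have sAB j : size (A j) = (size (B j) + size u * (size t).-1)%N.
  by rewrite sA sB mulnDl mulnAC -{1}(prednK L0) mulnS; lia.
have PA j : path (child w) a (A j) /\ last a (A j) = a by exact: repeat_path_cycle.
have PB j : path (child w) a (B j) /\ last a (B j) = b.
  have [h1 h2] := repeat_path_cycle (j * size t) pt' lt'.
  by rewrite cat_path last_cat pu lu.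
have [j hj] : exists j, take (size (B j)) (A j) <> B j.
  apply: contrapT => nj.
  have eq j : A j = B j ++ drop (size (B j)) (A j).
    rewrite -{1}(cat_take_drop (size (B j)) (A j)); congr (_ ++ _).
    by apply: contrapT => h; apply: nj; exists j.
  pose del := lam * (size t')%:R - lam' * (size t)%:R.
  have d0 : 0 < `|del| by rewrite normr_gt0 subr_eq0; apply/eqP.
  pose lp := - ln p0.
  have lp0 : 0 <= lp by rewrite oppr_ge0 ln_le0// -(p_sum1 w) (bigD1 ord0)//= lerDl sumr_ge0// => *; exact: p_ge0.
  (* Errors of both growth estimates, the |u| extra turns of t, and the descents along u and along
     the rest of A_j. *)
  pose K := C + C' + (size u)%:R * `|lam| + ((size u)%:R + (size u * (size t).-1)%:R) * lp.
  have bound j : j%:R * `|del| <= K.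
    have [pa la] := PA j; have [pb lb] := PB j.
    have pa' := pa; rewrite eq cat_path lb in pa'; case/andP: pa' => _ pr.
    have pu0 : path (child w) (charvec w n0 D0) u by rewrite -aE.
    have pb0 : path (child w) (charvec w n0 D0) (B j) by rewrite -aE.
    have [Un _ Ua] := descP Hmu Dn0 pu0; rewrite -aE lu in Ua.
    have [Bn _ Ba] := descP Hmu Dn0 pb0; rewrite -aE lb in Ba.
    have h1 := hC _ _ (size u + j * size t')%N Dn0 (esym aE).
    have h2 := hC' _ _ (j * size t)%N Un Ua.
    have h3 := log_mass_desc_le Hmu Dn0 pu0.
    have h4 := log_mass_desc_ge Hmu Dn0 pu0.
    rewrite -Ba in pr.
    have h5 := log_mass_desc_le Hmu Bn pr.
    have h6 := log_mass_desc_ge Hmu Bn pr.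
    have sr : size (drop (size (B j)) (A j)) = (size u * (size t).-1)%N.
      by rewrite size_drop sAB addKn.
    rewrite -desc_cat -addnA -size_cat -eq sr in h5 h6.
    rewrite -[repeat_path _ t]/(A j) -sA in h1.
    have eB : (n0 + size u + j * size t * size t' = n0 + size (B j))%N.
      by rewrite sB addnA.
    rewrite -desc_cat -/(B j) eB in h2.
    move: h1 h2 h3 h4 h5 h6.
    set lA := log_mass _ _ _; set lB := log_mass _ _ (desc w n0 D0 (B j)).
    set lU := log_mass _ _ (desc w n0 D0 u); set l0 := log_mass _ _ D0.
    rewrite !natrD !natrM !ler_norml => /andP[? ?] /andP[? ?] ? ? ? ?.
    have x1 : (size u)%:R * lam <= (size u)%:R * `|lam|.
      by apply: ler_wpM2l; rewrite ?ler0n ?ler_norm.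
    have x2 : (size u)%:R * - lam <= (size u)%:R * `|lam|.
      by apply: ler_wpM2l; rewrite ?ler0n// -normrN ler_norm.
    have x3 : 0 <= ((size u)%:R + (size u)%:R * (size t).-1%:R) * lp.
      by rewrite mulr_ge0 ?addr_ge0 ?mulr_ge0.
    rewrite -[j%:R]ger0_norm ?ler0n// -normrM ler_norml /K natrM /del.
    by apply/andP; split; move: x3; rewrite /lp; lra.
  have := bound (Num.truncn (K / `|del|)).+1; rewrite leNgt => /negP; apply.
  by rewrite -ltr_pdivrMr// truncnS_gt.
have szj : size (take (size (B j)) (A j)) = size (B j).
  by rewrite size_take_min sAB; apply/minn_idPl; rewrite leq_addr.
have [pa la] := PA j; have [pb lb] := PB j.
(* The two distinct paths are completed to cycles at a: the prefix of A_j by the rest of A_j, and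
   B_j by v. *)
have H := @interior_of_distinct a _ (drop (size (B j)) (A j)) _ v szj hj.
rewrite !cat_take_drop in H.
have pBv : path (child w) a (B j ++ v) by rewrite cat_path pb lb.
have lBv : last a (B j ++ v) = a by rewrite last_cat lb.
exists (A j ++ (B j ++ v)); split.
- by rewrite cat_path pa la.
- by rewrite last_cat la.
exact: H.
Qed.

(** The odd numbers 1, 3, ..., 2k - 1 add up to k^2; this is why the block lengths are proportional
    to 2k + 1. *)
Lemma quadratic_growth (f : nat -> R) A C :
  (forall k, `|f k.+1 - f k - (2 * k + 1)%:R * A| <= C) ->
  forall k, `|f k - f 0%N - A * k%:R ^+ 2| <= C * k%:R.
Proof.
move=> hf; elim=> [|k IH]; first by rewrite expr0n/= !mulr0 subrr subr0 normr0.
have := hf k; move: IH; rewrite -(natr1 k) natrD natrM !ler_norml.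
by move=> /andP[? ?] /andP[? ?]; apply/andP; split; nra.
Qed.

Lemma nested_point (E : nat -> interv R) :
  (forall k, (E k).1 <= (E k).2) -> (forall k, subinterv (E k.+1) (E k)) ->
  exists x, forall k, (E k).1 <= x <= (E k).2.
Proof.
move=> le sub.
have mono i k : (E i).1 <= (E (i + k)%N).1 /\ (E (i + k)%N).2 <= (E i).2.
  elim: k => [|k [h1 h2]]; first by rewrite addn0.
  by rewrite addnS; have /subintervP[? ?] := sub (i + k)%N; split; lra.
have ub k : ubound (range (fun i => (E i).1)) (E k).2.
  move=> _ [i _ <-]; have [h _] := mono i k; have [_ h'] := mono k i.
  by apply: (le_trans h); apply: le_trans h'; rewrite addnC le.
exists (sup (range (fun i => (E i).1))) => k; apply/andP; split.
  by apply: ub_le_sup; [exists (E 0%N).2|exists k].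
by apply: ge_sup => //; exists (E 0%N).1, 0%N.
Qed.

End Mixing.

(** * A point whose path mixes two cycles in prescribed proportions *)

Section MixedPoint.
Variables (R : realType) (w : wifs R) (mu : probability (measurableTypeR R) R).
Hypothesis Hmu : standard_assumptions w mu.
Local Notation p0 := (@p R w ord0).

Lemma log_mass_desc_dist n D s : D \in net w n ->
  path (child w) (charvec w n D) s ->
  `|log_mass w (n + size s) (desc w n D s) - log_mass w n D| <= (size s)%:R * - ln p0.
Proof.
move=> Dn ps; have h1 := log_mass_desc_le Hmu Dn ps; have h2 := log_mass_desc_ge Hmu Dn ps.
by rewrite ler_norml; apply/andP; split; lra.
Qed.

(** At level N k, just after the copies of iota opening block k, the ball of radius rho^(N k) around
    x contains the net interval reached there and lies inside the one where the block begins. Its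
    mass is thus comparable with Q at the start of the block, and [locdim_criterion] applies. *)
Lemma mixed_locdim a t b t' u v iota lam lam' (tau tau' : R) :
  admissible_cycle w a t -> growth_rate w a t lam ->
  admissible_cycle w b t' -> growth_rate w b t' lam' ->
  path (child w) a u -> last a u = b -> path (child w) b v -> last b v = a ->
  path (child w) a iota -> last a iota = a ->
  (forall n D, D \in net w n -> charvec w n D = a ->
    D.1 < (desc w n D iota).1 /\ (desc w n D iota).2 < D.2) ->
  0 <= tau -> 0 <= tau' ->
  0 < tau * (size t)%:R + tau' * (size t')%:R ->
  exists2 x, 0 <= x <= 1 &
    locdim_quotient mu x r @[r --> 0^'+] -->
    (tau * lam + tau' * lam') /
      ((tau * (size t)%:R + tau' * (size t')%:R) * ln (rho w)).
Proof.
move=> [_ [[n0 [D0 [Dn0 aE]]] pt] lt] [C hC] [_ [_ pt'] lt'] [C' hC'].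
move=> pu lu pv lv pi li inter tau0 tau0' Lam0.
have [c c0 sep] := isend_sep Hmu; have [J hJ] := rhoX_small w c0.
have i0 : (0 < size iota)%N.
  case: (iota) inter => // inter; have [] := inter _ _ Dn0 (esym aE).
  by rewrite ltxx.
(* Rounding changes each number of turns by at most 1, an O(1) error per block. *)
pose m k := Num.truncn ((2 * k + 1)%:R * tau).
pose m' k := Num.truncn ((2 * k + 1)%:R * tau').
(* The first iota leaves a gap of at least c rho^(n + |iota|) on both sides; the J further copies
   make rho^(N k) smaller than this gap. *)
have [K KE] : exists K, K = repeat_path J.+1 iota by eexists.
pose blk k := K ++ (repeat_path (m k) t ++ (u ++ (repeat_path (m' k) t' ++ v))).
(* st k holds the level and the net interval at which block k begins. *)
have [st [st0 stS]] : exists st : nat -> nat * interv R, st 0%N = (n0, D0) /\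
    forall k, st k.+1 = ((st k).1 + size (blk k), desc w (st k).1 (st k).2 (blk k))%N.
  by exists (fix st k := if k is k.+1 then
    ((st k).1 + size (blk k), desc w (st k).1 (st k).2 (blk k))%N else (n0, D0)).
have [pK lK] := repeat_path_cycle J.+1 pi li; rewrite -KE in pK lK.
have pt_ k := repeat_path_cycle (m k) pt lt.
have pt_' k := repeat_path_cycle (m' k) pt' lt'.
have pblk k : path (child w) a (blk k) /\ last a (blk k) = a.
  have [h1 h2] := pt_ k; have [h3 h4] := pt_' k.
  by rewrite /blk !cat_path !last_cat pK lK h1 h2 pu lu h3 h4 pv lv.
have stP k : (st k).2 \in net w (st k).1 /\ charvec w (st k).1 (st k).2 = a.
  elim: k => [|k [IH1 IH2]]; first by rewrite st0 -aE.
  have [h1 h2] := pblk k; rewrite -IH2 in h1.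
  by have [q1 _ q3] := descP Hmu IH1 h1; rewrite stS; split => //=; rewrite q3 IH2.
have stsub k : [/\ desc w (st k).1 (st k).2 K \in net w ((st k).1 + size K),
    path (child w) (charvec w (st k).1 (st k).2) K &
    subinterv (st k.+1).2 (desc w (st k).1 (st k).2 K)].
  have [h1 h2] := stP k; have [q1 q2] := pblk k.
  have q1' : path (child w) (charvec w (st k).1 (st k).2) (blk k) by rewrite h2.
  by have [r1 r2 _ _ r4] := desc_sub_prefix Hmu h1 q1'; rewrite stS.
have stsub1 k : subinterv (st k.+1).2 (st k).2.
  have [h1 h2] := stP k; have [q1 q2] := pblk k; rewrite -h2 in q1.
  by have [_ h _] := descP Hmu h1 q1; rewrite stS.
have [x hx] := @nested_point R (fun k => (st k).2)
  (fun k => ltW (net_lt (proj1 (stP k)))) stsub1.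
exists x.
  by have [? ?] := net_01 Hmu Dn0; have := hx 0%N; rewrite st0 => /andP[/= ? ?]; apply/andP; split; lra.
pose N k := ((st k).1 + size K)%N.
have [c' c'0 low] := mass_ge_cover Hmu.
pose lm k := log_mass w (st k).1 (st k).2.
have lower k : c' * cover_mass w (N k) (desc w (st k).1 (st k).2 K)
    <= mass mu `[x - rho w ^+ N k, x + rho w ^+ N k]%classic.
  have [h1 _ /subintervP[? ?]] := stsub k; apply: (le_trans (low _ _ h1)).
  have := net_len Hmu h1; rewrite -/(N k).
  by have /andP[? ?] := hx k.+1; move=> ?; apply: le_mass; lra.
have upper k : mass mu `[x - rho w ^+ N k, x + rho w ^+ N k]%classic
    <= cover_mass w (st k).1 (st k).2.
  have [h1 h2] := stP k; have [i1 i2] := inter _ _ h1 h2.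
  have [_ pKk /subintervP[s1 s2]] := stsub k.
  rewrite KE in pKk.
  have [F1 _ _ _ /subintervP[F2 F3]] := desc_sub_prefix Hmu h1 (s1 := iota) (s2 := repeat_path J iota) pKk.
  have /netP[e1 e2 _ _] := h1; have /netP[e3 e4 _ _] := F1.
  have kk : ((st k).1 <= (st k).1 + size iota)%N by rewrite leq_addr.
  have g1 := sep _ _ _ (isend_le Hmu kk e1) e3 i1.
  have g2 := sep _ _ _ e4 (isend_le Hmu kk e2) i2.
  have small : rho w ^+ N k < c * rho w ^+ ((st k).1 + size iota).
    rewrite /N KE size_repeat mulSn addnA exprD mulrC ltr_pM2r ?rhoX_gt0//.
    apply: le_lt_trans hJ; rewrite ler_wiXn2l ?(ltW (rho_gt0 w)) ?(ltW (rho_lt1 w))//.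
    by rewrite leq_pmulr.
  rewrite -[iota ++ _]/(repeat_path J.+1 iota) -KE in F2 F3.
  have rN := rhoX_gt0 w (N k); have /andP[x1 x2] := hx k.+1.
  have [l1 l2] : (st k).2.1 < x - rho w ^+ N k /\ x + rho w ^+ N k < (st k).2.2.
    by clear - g1 g2 small s1 s2 F2 F3 x1 x2; split; lra.
  by apply: (mass_le_cover Hmu h1) => //; clear - rN; lra.
pose lp := - ln p0.
have lp0 : 0 <= lp.
  rewrite oppr_ge0 ln_le0// -(p_sum1 w) (bigD1 ord0)//= lerDl sumr_ge0// => *.
  exact: p_ge0.
have tr (y : R) : 0 <= y -> `|(Num.truncn y)%:R - y| <= 1.
  move=> /truncn_itv/andP[q1 q2]; rewrite ler_norml -natr1 in q2 *.
  by apply/andP; split; lra.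
have trm k : `|(m k)%:R - (2 * k + 1)%:R * tau| <= 1 by apply: tr; rewrite mulr_ge0.
have trm' k : `|(m' k)%:R - (2 * k + 1)%:R * tau'| <= 1 by apply: tr; rewrite mulr_ge0.
pose L := tau * (size t)%:R + tau' * (size t')%:R.
pose Sc := (size K)%:R + (size u)%:R + (size v)%:R : R.
have levstep k : `|(st k.+1).1%:R - (st k).1%:R - (2 * k + 1)%:R * L|
    <= Sc + (size t)%:R + (size t')%:R.
  have scale (q z : R) i : `|q - z| <= 1 -> `|(q - z) * i%:R| <= i%:R.
    by move=> h; rewrite normrM [`|i%:R|]ger0_norm ?ler0n// ler_piMl ?ler0n.
  have := scale _ _ (size t) (trm k); have := scale _ _ (size t') (trm' k).
  rewrite stS /= !size_cat !size_repeat 5!natrD !natrM /L /Sc.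
  set T : R := (2 * k + 1)%:R; set M := (m k)%:R; set M' := (m' k)%:R.
  have := ler0n R (size u); have := ler0n R (size v); have := ler0n R (size K).
  clear; rewrite !ler_norml.
  by move=> ? ? ? /andP[? ?] /andP[? ?]; apply/andP; split; lra.
(* The block is split into its five pieces: K, u and v cost at most their lengths times lp, and the
   two repeated cycles follow their growth rates. *)
have lmstep k : `|lm k.+1 - lm k - (2 * k + 1)%:R * (tau * lam + tau' * lam')|
    <= Sc * lp + C + C' + `|lam| + `|lam'|.
  have [h1 h2] := stP k.
  have [E1 P1 _] := stsub k.
  have d1 := log_mass_desc_dist h1 P1.
  have A1 : charvec w ((st k).1 + size K) (desc w (st k).1 (st k).2 K) = a.
    by have [_ _ ->] := descP Hmu h1 P1; rewrite h2.
  set n1 := (_ + size K)%N in E1 A1 d1; set D1 := desc w _ _ K in E1 A1 d1.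
  have d2 := hC _ _ (m k) E1 A1.
  have P2 : path (child w) (charvec w n1 D1) (repeat_path (m k) t).
    by rewrite A1; case: (pt_ k).
  have [E2 _ A2] := descP Hmu E1 P2; rewrite A1 (proj2 (pt_ k)) in A2.
  rewrite -size_repeat in d2.
  set n2 := (n1 + _)%N in E2 A2 d2; set D2 := desc w n1 D1 _ in E2 A2 d2.
  have P3 : path (child w) (charvec w n2 D2) u by rewrite A2.
  have d3 := log_mass_desc_dist E2 P3.
  have [E3 _ A3] := descP Hmu E2 P3; rewrite A2 lu in A3.
  set n3 := (n2 + _)%N in E3 A3 d3; set D3 := desc w n2 D2 _ in E3 A3 d3.
  have d4 := hC' _ _ (m' k) E3 A3.
  have P4 : path (child w) (charvec w n3 D3) (repeat_path (m' k) t').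
    by rewrite A3; case: (pt_' k).
  have [E4 _ A4] := descP Hmu E3 P4; rewrite A3 (proj2 (pt_' k)) in A4.
  rewrite -size_repeat in d4.
  set n4 := (n3 + _)%N in E4 A4 d4; set D4 := desc w n3 D3 _ in E4 A4 d4.
  have P5 : path (child w) (charvec w n4 D4) v by rewrite A4.
  have d5 := log_mass_desc_dist E4 P5.
  have e : lm k.+1 = log_mass w (n4 + size v) (desc w n4 D4 v).
    rewrite /lm stS /= /blk !desc_cat !size_cat !addnA.
    by rewrite /D4 /n4 /D3 /n3 /D2 /n2 /D1 /n1.
  rewrite e /lm; move: d1 d2 d3 d4 d5.
  set q0 := log_mass w (st k).1 _; set q1 := log_mass w n1 _.
  set q2 := log_mass w n2 _; set q3 := log_mass w n3 _; set q4 := log_mass w n4 _.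
  set q5 := log_mass w (n4 + size v)%N _.
  rewrite -/lp; set T : R := (2 * k + 1)%:R => d1 d2 d3 d4 d5.
  have l1 : `|((m k)%:R - T * tau) * lam| <= `|lam|.
    by rewrite normrM ler_piMl//; exact: trm.
  have l2 : `|((m' k)%:R - T * tau') * lam'| <= `|lam'|.
    by rewrite normrM ler_piMl//; exact: trm'.
  move: d1 d2 d3 d4 d5 l1 l2; rewrite /Sc; clear; rewrite !ler_norml.
  move=> /andP[? ?] /andP[? ?] /andP[? ?] /andP[? ?] /andP[? ?] /andP[? ?] /andP[? ?].
  by apply/andP; split; lra.
have G1 := quadratic_growth levstep; have G2 := quadratic_growth lmstep.
set B1 := Sc + _ + _ in G1; set B2 := Sc * lp + _ + _ + _ + _ in G2.
have B10 : 0 <= B1 by exact: le_trans (levstep 0%N).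
have B20 : 0 <= B2 by exact: le_trans (lmstep 0%N).
have Q0 k : 0 < cover_mass w (st k).1 (st k).2.
  by apply: (cover_mass_gt0 Hmu); case: (stP k).
have QK0 k : 0 < cover_mass w (N k) (desc w (st k).1 (st k).2 K).
  by apply: (cover_mass_gt0 Hmu); case: (stsub k).
have m0 k : 0 < mass mu `[x - rho w ^+ N k, x + rho w ^+ N k]%classic.
  by apply: lt_le_trans (lower k); rewrite mulr_gt0.
pose C2 := B1 + B2 + (n0 + size K)%:R + `|lm 0%N| + `|ln c'| + (size K)%:R * lp.
have z1 := normr_ge0 (lm 0%N); have z2 := normr_ge0 (ln c').
have z3 : 0 <= (size K)%:R * lp by rewrite mulr_ge0.
have z4 := ler0n R (n0 + size K).
apply: (@locdim_criterion R w mu x _ L C2 N) => // k; have k0 := ler0n R k.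
  have C2B : B1 * k%:R + (n0 + size K)%:R <= C2 * k.+1%:R.
    by rewrite -(natr1 k) /C2; nra.
  apply: le_trans C2B; have := G1 k; rewrite /N natrD st0 natrD !ler_norml.
  have := ler0n R n0; have := ler0n R (size K); clear.
  by move=> ? ? /andP[? ?]; apply/andP; split; lra.
have C2B : B2 * k%:R + `|lm 0%N| + `|ln c'| + (size K)%:R * lp <= C2 * k.+1%:R.
  rewrite -(natr1 k) /C2; set z := (size K)%:R * lp in z3 *; nra.
apply: le_trans C2B.
have up : ln (mass mu `[x - rho w ^+ N k, x + rho w ^+ N k]%classic) <= lm k.
  by rewrite ler_ln ?posrE//; exact: upper.
have lo : ln c' + log_mass w (N k) (desc w (st k).1 (st k).2 K)
    <= ln (mass mu `[x - rho w ^+ N k, x + rho w ^+ N k]%classic).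
  by rewrite -lnM ?posrE// ler_ln ?posrE ?mulr_gt0//; exact: lower.
have [h1 h2] := stP k; have [_ P1 _] := stsub k.
have := ler_norm (lm 0%N); have := ler_norm (- lm 0%N); have := ler_norm (- ln c').
rewrite !normrN; have := log_mass_desc_dist h1 P1; rewrite -/(N k) -/(lm k) -/lp.
move: (G2 k) up lo; clear; rewrite !ler_norml.
by move=> /andP[? ?] ? ? /andP[? ?] ? ? ?; apply/andP; split; lra.
Qed.

End MixedPoint.

(** * Realizing every value between the two local dimensions *)

Lemma locdim_eq (R : realType) (mu : probability (measurableTypeR R) R) (x l : R) :
  locdim_quotient mu x r @[r --> 0^'+] --> l -> has_locdim mu x /\ locdim mu x = l.
Proof. by move=> h; split; [exact: cvgP h|exact: cvg_lim h]. Qed.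

Lemma periodic_growth (R : realType) (w : wifs R)
    (mu : probability (measurableTypeR R) R) (Hmu : standard_assumptions w mu)
    (X : set (cvec R)) (x : R) : positive_periodic w X x ->
  exists a t lam, [/\ X a, admissible_cycle w a t, growth_rate w a t lam,
    0 <= x <= 1 & locdim_quotient mu x r @[r --> 0^'+] -->
      lam / ((size t)%:R * ln (rho w))].
Proof.
move=> [a [t [hp Xat pos]]]; have [cy [g [s [[Delta [Dx Dch _]] _]]]] := hp.
have [lam hl] := log_mass_growth Hmu cy pos.
exists a, t, lam; split => //; first by apply: Xat; rewrite mem_head.
  have [? ?] := net_01 Hmu (chain_net Dch 0%N); have /andP[? ?] := Dx 0%N.
  by apply/andP; split; lra.
exact: periodic_locdim hp hl.
Qed.

Theorem theorem5p7 (R : realType) (w : wifs R)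
    (mu : probability (measurableTypeR R) R)
    (Hmu : standard_assumptions w mu)
    (Omega' : set (cvec R))
    (Hloop : loop_class w Omega')
    (Hpos : positive_type w Omega')
    (y z : R)
    (Hy : positive_periodic w Omega' y)
    (Hz : positive_periodic w Omega' z) :
  `[Num.min (locdim mu y) (locdim mu z),
    Num.max (locdim mu y) (locdim mu z)]%classic
      `<=` locdims mu.
Proof.
have [a [t [lam [Xa cy gr y01 cvy]]]] := periodic_growth Hmu Hy.
have [b [t' [lam' [Xb cy' gr' z01 cvz]]]] := periodic_growth Hmu Hz.
have [hy ly] := locdim_eq cvy; have [hz lz] := locdim_eq cvz.
case: Hloop => _ _ loop.
have [u [_ [_ pu] _ lu]] := loop _ _ Xa Xb; have [v [_ [_ pv] _ lv]] := loop _ _ Xb Xa.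
have L0 : 0 < (size t)%:R :> R by rewrite ltr0n; case: cy; case: (t).
have L0' : 0 < (size t')%:R :> R by rewrite ltr0n; case: cy'; case: (t').
have lr := ln_rho_lt0 w.
move=> D /=; rewrite in_itv/= => /andP[D1 D2].
(* When the two dimensions agree the interval is a single point, attained at y. *)
have [e|ne] := eqVneq (locdim mu y) (locdim mu z).
  exists y; first by split.
  by move: D1 D2; rewrite -e minxx maxxx => D1 D2; apply/le_anti; rewrite D1 D2.
(* Distinct dimensions mean distinct growth rates per level, as [interior_cycle] demands. *)
have nl : lam * (size t')%:R <> lam' * (size t)%:R.
  move=> e; case/eqP: ne; rewrite ly lz.
  have -> : lam = lam' * (size t)%:R / (size t')%:R by rewrite -e mulfK// gt_eqF.
  by field; rewrite lt_eqF// !gt_eqF.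
have [iota [pi li hi]] := interior_cycle Hmu cy gr cy' gr' pu lu pv lv nl.
have [s s01 DE] : exists2 s, 0 <= s <= 1 & D = (1 - s) * locdim mu y + s * locdim mu z.
  have zy : locdim mu z - locdim mu y != 0 by rewrite subr_eq0 eq_sym.
  exists ((D - locdim mu y) / (locdim mu z - locdim mu y)); last by field.
  move: D1 D2; rewrite minElt maxElt; case: ltgtP ne => // yz _ D1 D2.
    by rewrite ler_pdivlMr ?ler_pdivrMr ?subr_gt0//; apply/andP; split; lra.
  by rewrite ler_ndivlMr ?ler_ndivrMr ?subr_lt0//; apply/andP; split; lra.
have /andP[s0 s1] := s01.
(* Weights inversely proportional to the cycle lengths give the two cycles the shares 1 - s and s of
   the levels, so the limit becomes the convex combination D. *)
have Lam1 : (1 - s) / (size t)%:R * (size t)%:R + s / (size t')%:R * (size t')%:R = 1.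
  by rewrite !divfK ?gt_eqF// subrK.
have [||| x x01 cvx] := mixed_locdim Hmu cy gr cy' gr' pu lu pv lv pi li hi
   (tau := (1 - s) / (size t)%:R) (tau' := s / (size t')%:R).
- by rewrite divr_ge0 ?subr_ge0// ltW.
- by rewrite divr_ge0// ltW.
- by rewrite Lam1.
have [hx lx] := locdim_eq cvx; exists x => //.
rewrite lx Lam1 DE ly lz; field.
by rewrite lt_eqF// !gt_eqF.
Qed.
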